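(* There exists a non-constant analytic function $f$ on the unit disc $\mathbb{D}$ such that: (1) $f$ belongs to the Smirnov class $\mathcal{N}_+$, i.e. $$\log|f(z)|\le \int_{\mathbb T} \log|f(\zeta)| \,\mathrm{Re} \left(\frac{\zeta+z}{\zeta-z}\right) dm(\zeta)\quad \text{for all } z\in\mathbb D;$$ (2) $\liminf_{t\to\infty} t\, m_f(t) = 0$; and (3) $\mathrm{Re} f = 0$ almost everywhere on $\mathbb{T}$.
   Context: $\mathbb D$ is the open unit disc, $\mathbb T$ the unit circle, and $m$ the normalized Lebesgue measure on $\mathbb T$ ($m(\mathbb T)=1$). For an analytic function $f$ on $\mathbb D$ with non-tangential boundary values a.e. on $\mathbb T$, the same letter $f$ denotes these boundary values, and $m_f(t)=m\{\zeta\in\mathbb T : |f(\zeta)|\ge t\}$ for $t>0$. *)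

(* Defs.v *)
From HB Require Import structures.
From mathcomp Require Import all_boot all_order all_algebra.
From mathcomp Require Import all_classical all_reals all_analysis.
From mathcomp Require Import complex.
Export Order.TTheory GRing.Theory Num.Theory numFieldTopology.Exports
  numFieldNormedType.Exports.

Set Implicit Arguments.
Unset Strict Implicit.
Unset Printing Implicit Defensive.

Local Open Scope classical_set_scope.
Local Open Scope ring_scope.
Local Open Scope complex_scope.

Notation Cx R := ((R[i])^o).

Section Defs.
Variable R : realType.

Definition modc (w : R[i]) : R := complex.Re `|w|.

Definition udisc : set (Cx R) := [set z | modc z < 1].

(* f is analytic (holomorphic) on D: complex-differentiable at each point
   of D ([derivable f z 1] with scalars in C is the complex derivative). *)
Definition analytic_on_disc (f : Cx R -> Cx R) : Prop :=
  forall z : Cx R, udisc z -> derivable f z 1.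

Definition expi (t : R) : Cx R := (cos t) +i* (sin t).

Definition Tpar : set R := `[0, pi *+ 2[%classic.

Definition stolz (alpha : R) (zeta : Cx R) : set (Cx R) :=
  [set z | modc z < 1 /\ modc (z - zeta) < alpha * (1 - modc z)].

Definition nt_limit (f : Cx R -> Cx R) (zeta : Cx R) (L : Cx R) : Prop :=
  forall alpha : R, 1 < alpha -> f @ within (stolz alpha zeta) (nbhs zeta) --> L.

Definition elog (x : R) : \bar R := if x == 0 then -oo%E else (ln x)%:E.

Definition poisson (z : Cx R) (t : R) : R :=
  complex.Re ((expi t + z) / (expi t - z)).

Definition mT (A : set R) : \bar R :=
  (((pi *+ 2)^-1)%:E * (@lebesgue_measure R) (Tpar `&` A))%E.

(* distribution function m_f(t) = m{zeta in T : |f(zeta)| >= t}, with the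
   boundary function given as fb : R -> C, fb theta = f(e^{i theta}) *)
Definition distr_fun (fb : R -> Cx R) (t : R) : \bar R :=
  mT [set th | t <= modc (fb th)].

End Defs.

(* Main.v *)
(**
   The function is [f z = i * g (v z)], where [v z = - ((1 + z) / (1 - z)) ^+ 2]
   maps the unit circle to the half-line [y >= 0] and [g] is a real entire
   function with [g >= 1] there; hence [Re f = 0] on the circle.

   [g] is the limit of real polynomials [E k >= 1], with [E 0 = 1 + 'X^2] and
   [E k.+1 = E k \Po S k].  Here [S k] is a rescaled iterate of the logistic map
   [s |-> 4 s (1 - s)]: it is close to ['X] on a large disc, yet it folds a huge
   interval [0 <= y <= a ^+ 2] into a much shorter one, so [E k.+1] is bounded
   on that interval by some [t] with [t / a] small.  Since the points with
   [v > a ^+ 2] have measure [O(1 / a)], this gives [t * m_f t -> 0] along a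
   sequence.

   For a polynomial [E] positive on the half-line, [ln |E (v z)|] is at most the
   Poisson integral of [ln (E \o v)]: split [E (v z)] into factors
   [(a + b z) / (1 - z)] and apply Jensen's formula to each of them.  The growth
   of the iterates is controlled by
   [ln (E k.+1) <= ln (E k) + e + K1 ln (1 + v / a1 ^+ 2) + K2 ln (1 + v / a2 ^+ 2)]
   with [K1 / a1 + K2 / a2 <= e], and the mean of [ln (1 + v / a ^+ 2)] is
   at most [2 / a]; thus the [ln (E k \o v)] have a common integrable majorant
   and the inequality passes to the limit.
*)
Require Import Defs.
From HB Require Import structures.
From mathcomp Require Import all_boot all_order all_algebra.
From mathcomp Require Import all_classical all_reals all_analysis.
From mathcomp Require Import complex measurable_realfun.
From mathcomp Require Import ring lra.
Import Order.TTheory GRing.Theory Num.Theory numFieldTopology.Exports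
  numFieldNormedType.Exports.
Set Implicit Arguments.
Unset Strict Implicit.
Unset Printing Implicit Defensive.
Local Open Scope classical_set_scope.
Local Open Scope ring_scope.
Local Open Scope complex_scope.

(** * Modulus and boundary circle *)

Section modulus.
Variable R : realType.

(** What makes the folding affordable is a match of two growth rates. Folding [m] times multiplies
    the degree by [2 ^ m], and the Poisson mean of [K * ln (1 + v / a ^+ 2)] is of order [K / a];
    but the interval folded into [[0, M]] has length [4 ^ m * M], so its square root [a] gains the
    same factor [2 ^ m]. The cost [K / a] is therefore independent of [m], and so is the bound [t]
    on the folded interval. Hence [M] is fixed first, large enough for the cost and for the
    perturbation near the origin, and [m] is chosen last, to make [t / a] small. The folding is
    substituted inside [E k] because this preserves [E k >= 1] on the real line. That lower bound
    keeps the logarithms nonnegative on the circle, so that a one-sided majorant suffices for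
    dominated convergence, and it keeps the zeros of [E k] off the half-line that carries the
    boundary values of [v]. *)

Lemma modcC (w : R[i]) : (modc w)%:C = `|w|.
Proof. by rewrite /modc normc_def. Qed.

Lemma modcM (v w : R[i]) : modc (v * w) = modc v * modc w.
Proof. by apply: complexI; rewrite rmorphM /= !modcC normrM. Qed.

Lemma modcV (w : R[i]) : modc w^-1 = (modc w)^-1.
Proof. by apply: complexI; rewrite fmorphV /= !modcC normfV. Qed.

Lemma modcX (w : R[i]) n : modc (w ^+ n) = modc w ^+ n.
Proof. by apply: complexI; rewrite rmorphXn /= !modcC normrX. Qed.

Lemma modcN (w : R[i]) : modc (- w) = modc w.
Proof. by apply: complexI; rewrite !modcC normrN. Qed.

Lemma modcD (v w : R[i]) : modc (v + w) <= modc v + modc w.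
Proof. by rewrite -lecR rmorphD /= !modcC ler_normD. Qed.

Lemma modc_ge0 (w : R[i]) : 0 <= modc w.
Proof. by rewrite /modc normc_def /= sqrtr_ge0. Qed.

Lemma modc_eq0 (w : R[i]) : (modc w == 0) = (w == 0).
Proof. by rewrite -(inj_eq (@complexI _)) modcC normr_eq0. Qed.

Lemma modc_gt0 (w : R[i]) : (0 < modc w) = (w != 0).
Proof. by rewrite lt_neqAle modc_ge0 andbT eq_sym modc_eq0. Qed.

Lemma modc0 : modc (0 : R[i]) = 0.
Proof. by apply/eqP; rewrite modc_eq0. Qed.

Lemma modc1 : modc (1 : R[i]) = 1.
Proof. by apply: complexI; rewrite modcC normr1. Qed.

Lemma modc_sqr (w : R[i]) : modc w ^+ 2 = complex.Re w ^+ 2 + complex.Im w ^+ 2.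
Proof. by apply: complexI; rewrite rmorphXn /= modcC add_Re2_Im2. Qed.

Lemma modc_real (x : R) : modc x%:C = `|x|.
Proof. by rewrite /modc normc_def /= expr0n /= addr0 sqrtr_sqr. Qed.

Lemma modcJ (w : R[i]) : modc w^*%C = modc w.
Proof. by rewrite /modc normcJ. Qed.

Lemma Re_le_modc (w : R[i]) : `|complex.Re w| <= modc w.
Proof. by rewrite -lecR modcC normc_ge_Re. Qed.

Lemma near_modc (w : Cx R) (e : R) : 0 < e -> \forall v \near w, modc (v - w) < e.
Proof.
move=> e0; have e0' : (0 : R[i]) < e%:C by rewrite ltcR.
have := @nbhsx_ballx _ (Cx R) w _ e0'.
apply: filterS => v; rewrite /ball /= => h.
by rewrite -ltcR modcC distrC.
Qed.

Lemma cvgC_modc (T : Type) (F : set_system T) {FF : Filter F} (f : T -> Cx R) (l : Cx R) :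
  (forall e : R, 0 < e -> \forall x \near F, modc (f x - l) < e) -> f @ F --> l.
Proof.
move=> H; apply/(@cvgrPdist_lt _ (Cx R)) => e e0.
have eE : e = (complex.Re e)%:C by rewrite RRe_real // realE ltW.
have : 0 < complex.Re e by rewrite -ltcR -eE.
move=> /H; apply: filterS => x; rewrite distrC -ltcR modcC -eE //.
Qed.

Lemma Re_cvg (w : Cx R) : complex.Re v @[v --> w] --> complex.Re w.
Proof.
apply/(@cvgrPdist_lt _ R^o _ _ (nbhs_filter w)) => e e0.
have := near_modc w e0; apply: filterS => v.
by apply: le_lt_trans; rewrite distrC -raddfB Re_le_modc.
Qed.

Lemma modc_le_norm (w : R[i]) : modc w <= `|complex.Re w| + `|complex.Im w|.
Proof.
rewrite -ler_sqr ?nnegrE ?modc_ge0 ?addr_ge0 // modc_sqr sqrrD !real_normK ?num_real //.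
by rewrite addrAC lerDl mulrn_wge0 // mulr_ge0.
Qed.

Lemma expi_cvg (t : R) : expi s @[s --> t] --> expi t.
Proof.
apply: cvgC_modc => e e0.
have e2 : 0 < e / 2 by rewrite divr_gt0.
have hc := @cvgr_dist_lt _ R^o _ _ _ _ _ (@continuous_cos R t) _ e2.
have hs := @cvgr_dist_lt _ R^o _ _ _ _ _ (@continuous_sin R t) _ e2.
near=> s.
apply: le_lt_trans (modc_le_norm _) _ => /=.
rewrite [ltRHS](splitr e) ltrD // distrC; near: s; [exact: hc | exact: hs].
Unshelve. all: end_near.
Qed.

Lemma modc_expi t : modc (@expi R t) = 1.
Proof.
apply/eqP; rewrite -sqrp_eq1 ?modc_ge0 // modc_sqr /=.
by rewrite cos2Dsin2.
Qed.

Lemma expiD s t : @expi R (s + t) = expi s * expi t.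
Proof.
rewrite /expi cosD sinD; apply/eqP.
by rewrite eq_complex /= eqxx addrC /= mulrC [X in _ + X]mulrC eqxx.
Qed.

Lemma expiX t n : @expi R t ^+ n = expi (n%:R * t).
Proof.
elim: n => [|n IH]; first by rewrite mul0r expr0 /expi cos0 sin0.
by rewrite exprS IH -expiD mulrSr mulrDl mul1r addrC.
Qed.

Lemma expi2pi : @expi R (pi *+ 2) = 1.
Proof. by rewrite /expi cos2pi sin2pi. Qed.

Lemma continuous_Re_circle (g : Cx R -> Cx R) :
  (forall t : R, g w @[w --> expi t] --> g (expi t)) ->
  continuous (fun t : R => complex.Re (g (expi t)) : R).
Proof.
move=> gc t.
have h : g (expi s) @[s --> t] --> g (expi t) by apply: cvg_comp (gc t); exact: expi_cvg.
by apply: cvg_comp h _; exact: Re_cvg.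
Qed.

Lemma cvgCM (w : Cx R) (f g : Cx R -> Cx R) (a b : Cx R) :
  f v @[v --> w] --> a -> g v @[v --> w] --> b -> (f v * g v : Cx R) @[v --> w] --> (a * b : Cx R).
Proof. exact: (@cvgM R[i] _ _ (nbhs_filter w) f g a b). Qed.

Lemma cvgCV (w : Cx R) (f : Cx R -> Cx R) (a : Cx R) :
  a != 0 -> f v @[v --> w] --> a -> ((f v)^-1 : Cx R) @[v --> w] --> (a^-1 : Cx R).
Proof. exact: (@cvgV R[i] _ _ (nbhs_filter w) f a). Qed.

Lemma cvgCB (w : Cx R) (f g : Cx R -> Cx R) (a b : Cx R) :
  f v @[v --> w] --> a -> g v @[v --> w] --> b -> (f v - g v : Cx R) @[v --> w] --> (a - b : Cx R).
Proof. exact: (@cvgB _ (Cx R) _ _ (nbhs_filter w)). Qed.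

Lemma cvgCD (w : Cx R) (f g : Cx R -> Cx R) (a b : Cx R) :
  f v @[v --> w] --> a -> g v @[v --> w] --> b -> (f v + g v : Cx R) @[v --> w] --> (a + b : Cx R).
Proof. exact: (@cvgD _ (Cx R) _ _ (nbhs_filter w)). Qed.

Lemma cvgC_cst (w c : Cx R) : c @[v --> w] --> c.
Proof. exact: (@cvg_cst _ _ _ (nbhs w) (nbhs_filter w)). Qed.

Lemma cvgC_id (w : Cx R) : v @[v --> w] --> w.
Proof. exact: cvg_id. Qed.

Lemma cvgCX (w : Cx R) n : (v ^+ n : Cx R) @[v --> w] --> (w ^+ n : Cx R).
Proof.
elim: n => [|n IH]; first by rewrite expr0; exact: cvgC_cst.
rewrite [X in _ --> X]exprS; under eq_fun do rewrite exprS.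
by apply: cvgCM IH; exact: cvgC_id.
Qed.

Lemma poissonE (z : Cx R) t : poisson z t = (1 - modc z ^+ 2) / modc (expi t - z) ^+ 2.
Proof.
rewrite /poisson !modc_sqr /expi; case: z => a b /=.
have cs := cos2Dsin2 t.
set c := cos t in cs *; set s := sin t in cs *.
rewrite mulrN opprK; set d := (_ + _ ^+ 2).
rewrite mulrA mulrA -mulrDl; congr (_ / _).
rewrite -cs; ring.
Qed.

End modulus.

(** * Poisson integrals *)

Section poisson_integral.
Variable R : realType.

Notation mu := (@lebesgue_measure R).
Notation T := (@Tpar R).

Lemma measurable_Tpar : measurable T.
Proof. exact: measurable_itv. Qed.
Hint Resolve measurable_Tpar : core.

Lemma pi2_gt0 : 0 < pi *+ 2 :> R.
Proof. by rewrite mulrn_wgt0 // pi_gt0. Qed.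

Lemma mu_Tpar : mu T = (pi *+ 2)%:E.
Proof. by rewrite /Tpar lebesgue_measure_itv /= lte_fin pi2_gt0 sube0. Qed.

Lemma continuous_integrable (g : R -> R) : continuous g -> mu.-integrable T (EFin \o g).
Proof.
move=> gc; apply: (@integrableS _ _ _ mu `[0, pi *+ 2]) => //.
  by apply: subset_itvl; rewrite bnd_simp.
apply: continuous_compact_integrable; first exact: segment_compact.
by apply: continuous_subspaceT.
Qed.

Lemma cst_integrable (c : R) : mu.-integrable T (EFin \o cst c).
Proof. by apply: continuous_integrable; exact: cst_continuous. Qed.

Lemma expi_sub_neq0 (z : Cx R) t : udisc z -> expi t - z != 0.
Proof.
move=> zD; apply/eqP => /eqP; rewrite subr_eq0 => /eqP e.
by move: zD; rewrite /udisc /= -e modc_expi ltxx.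
Qed.

Lemma poisson_continuous (z : Cx R) : udisc z -> continuous (poisson z).
Proof.
move=> zD; apply: (@continuous_Re_circle R (fun w => (w + z) / (w - z))) => t.
apply: cvgCM; first by apply: cvgCD; [exact: cvgC_id|exact: cvgC_cst].
by apply: cvgCV; [exact: expi_sub_neq0|apply: cvgCB; [exact: cvgC_id|exact: cvgC_cst]].
Qed.

Lemma poisson_ge0 (z : Cx R) t : udisc z -> 0 <= poisson z t.
Proof.
move=> zD; rewrite poissonE divr_ge0 ?sqr_ge0 // subr_ge0 expr_le1 ?modc_ge0 //.
exact: ltW.
Qed.

Lemma modcB_ge (v w : R[i]) : modc v - modc w <= modc (v - w).
Proof. by rewrite lerBlDr -{1}[v](subrK w) modcD. Qed.

Lemma poisson_bounded (z : Cx R) : udisc z -> exists2 B : R, 0 <= B & forall t, poisson z t <= B.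
Proof.
move=> zD; have z1 : 0 < 1 - modc z by rewrite subr_gt0.
exists (1 / (1 - modc z) ^+ 2) => [|t]; first by rewrite divr_ge0 ?sqr_ge0.
have h : 1 - modc z <= modc (expi t - z) by apply: le_trans (modcB_ge _ _); rewrite modc_expi.
rewrite poissonE ler_pM //; first by rewrite subr_ge0 expr_le1 ?modc_ge0 // ltW.
- by rewrite invr_ge0 sqr_ge0.
- by rewrite gerBl sqr_ge0.
rewrite lef_pV2 ?posrE ?exprn_gt0 //; last exact: lt_le_trans h.
by rewrite lerXn2r // nnegrE ?modc_ge0 // ltW.
Qed.

Lemma integrable_poisson (z : Cx R) (g : R -> R) : udisc z -> mu.-integrable T (EFin \o g) ->
  mu.-integrable T (EFin \o (fun t => g t * poisson z t)).
Proof.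
move=> zD ig.
have [B B0 hB] := poisson_bounded zD.
have := @integrableMr _ _ _ mu T measurable_Tpar (poisson z) (EFin \o g).
move=> /(_ _ _ ig) h.
have -> : EFin \o (fun t => g t * poisson z t) = ((EFin \o poisson z) \* (EFin \o g))%E.
  by apply/funext => t /=; rewrite mulrC.
apply: h.
- apply: measurable_funTS; apply: continuous_measurable_fun; exact: poisson_continuous.
- exists B; split; [exact: num_real|move=> M BM t _ /=].
  by rewrite ger0_norm ?poisson_ge0 // (le_trans (hB t)) // ltW.
Qed.

Definition poisson_int (z : Cx R) (g : R -> R) : R :=
  (pi *+ 2)^-1 * \int[mu]_(t in T) (g t * poisson z t).

Lemma poisson_intD (z : Cx R) (f g : R -> R) : udisc z -> mu.-integrable T (EFin \o f) ->
  mu.-integrable T (EFin \o g) ->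
  poisson_int z (fun t => f t + g t) = poisson_int z f + poisson_int z g.
Proof.
move=> zD fi gi; rewrite /poisson_int -mulrDr -RintegralD //; try exact: integrable_poisson.
by congr (_ * _); apply: eq_Rintegral => t _; rewrite mulrDl.
Qed.

Lemma poisson_intZ (z : Cx R) (c : R) (f : R -> R) : udisc z -> mu.-integrable T (EFin \o f) ->
  poisson_int z (fun t => c * f t) = c * poisson_int z f.
Proof.
move=> zD fi; have := @RintegralZl _ _ _ mu T _ c measurable_Tpar (integrable_poisson zD fi).
rewrite /poisson_int mulrCA => <-.
by congr (_ * _); apply: eq_Rintegral => t _; rewrite mulrA.
Qed.

Lemma integrableZ (c : R) (f : R -> R) : mu.-integrable T (EFin \o f) ->
  mu.-integrable T (EFin \o (fun t => c * f t)).
Proof. by move=> fi; exact: (@integrableZl _ _ _ mu T measurable_Tpar c _ fi). Qed.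

Lemma integrableDR (f g : R -> R) : mu.-integrable T (EFin \o f) ->
  mu.-integrable T (EFin \o g) -> mu.-integrable T (EFin \o (fun t => f t + g t)).
Proof. by move=> fi gi; exact: (@integrableD _ _ _ mu _ _ _ _ fi gi). Qed.

(** The endpoint is left out because boundary formulas take default values there: at [t = 0] the
    point [expi t] is [1], where [1 - expi t] vanishes. *)
Lemma le_poisson_int (z : Cx R) (f g : R -> R) : udisc z -> mu.-integrable T (EFin \o f) ->
  mu.-integrable T (EFin \o g) ->
  (forall t, 0 < t < pi *+ 2 -> f t <= g t) -> poisson_int z f <= poisson_int z g.
Proof.
move=> zD fi gi fg; rewrite /poisson_int ler_pM2l ?invr_gt0 ?pi2_gt0 //.
have S : `]0, pi *+ 2[%classic `<=` T by apply: subset_itvr; rewrite bnd_simp.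
have fPi : mu.-integrable `]0, pi *+ 2[ (EFin \o (fun t => f t * poisson z t)).
  by apply: (@integrableS _ _ _ mu T) => //; exact: integrable_poisson.
have gPi : mu.-integrable `]0, pi *+ 2[ (EFin \o (fun t => g t * poisson z t)).
  by apply: (@integrableS _ _ _ mu T) => //; exact: integrable_poisson.
rewrite /Tpar -2?Rintegral_itv_obnd_cbnd //.
apply: le_Rintegral => // t /=; rewrite in_itv /= => t02.
by rewrite ler_wpM2r ?poisson_ge0 // fg.
Qed.

(** * Poisson integrals of monomials *)

Lemma Rintegral_expi (c : R[i]) k : \int[mu]_(t in T) complex.Re (c * expi t ^+ k.+1) = 0.
Proof.
case: c => a b; set m : R := k.+1%:R.
have m0 : m != 0 by rewrite pnatr_eq0.
pose f (t : R) := a * cos (m * t) - b * sin (m * t).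
pose F (t : R) := m^-1 * (a * sin (m * t) + b * cos (m * t)).
have fE t : complex.Re ((a +i* b) * expi t ^+ k.+1) = f t by rewrite expiX.
under eq_Rintegral do rewrite fE.
have dl t : is_derive (t : R) 1 (fun t => m * t : R) m.
  by apply: is_derive_eq; rewrite /GRing.scale /= mulr1.
have ds t : is_derive (t : R) 1 (fun t => sin (m * t) : R) (cos (m * t) * m).
  exact: (@is_derive1_comp _ _ _ _ _ _ (is_derive_sin _) (dl t)).
have dc t : is_derive (t : R) 1 (fun t => cos (m * t) : R) (- sin (m * t) * m).
  exact: (@is_derive1_comp _ _ _ _ _ _ (is_derive_cos _) (dl t)).
have dF t : is_derive (t : R) 1 F (f t).
  by apply: is_derive_eq; rewrite /GRing.scale /= /f; field.
have cf : continuous f.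
  move=> t; apply: cvgB; apply: cvgM; try exact: cvg_cst.
    apply: differentiable_continuous; exact/derivable1_diffP/(@ex_derive _ _ _ _ _ _ _ (dc t)).
  apply: differentiable_continuous; exact/derivable1_diffP/(@ex_derive _ _ _ _ _ _ _ (ds t)).
have cF : continuous F.
  move=> t; apply: differentiable_continuous;
    exact/derivable1_diffP/(@ex_derive _ _ _ _ _ _ _ (dF t)).
rewrite /Tpar Rintegral_itv_bndo_bndc; last exact: continuous_integrable.
rewrite /Rintegral (@continuous_FTC2 _ f F) ?pi2_gt0 //=.
- have e2 : @expi R (m * (pi *+ 2)) = expi (m * 0)
    by rewrite -!expiX expi2pi (_ : expi 0 = 1) // /expi cos0 sin0.
  by move: e2; rewrite /F => -[-> ->]; rewrite subrr.
- by apply: continuous_subspaceT.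
- split; first by move=> t _; exact: (@ex_derive _ _ _ _ _ _ _ (dF t)).
    by apply: cvg_at_right_filter; exact: cF.
  by apply: cvg_at_left_filter; exact: cF.
- by move=> t _; rewrite derive1E; exact: (@derive_val _ _ _ _ _ _ _ (dF t)).
Qed.

Lemma geometric_le0 (x C r : R) : 0 <= r < 1 -> (forall m, x <= C * r ^+ m) -> x <= 0.
Proof.
move=> /andP[r0 r1] h.
have : (fun m => C * r ^+ m) @ \oo --> C * 0.
  by apply: cvgM; [exact: cvg_cst|apply: cvg_expr; rewrite ger0_norm].
rewrite mulr0 => cv.
by apply: (cvgr_to_ge cv); apply: nearW.
Qed.

Lemma oneB_neq0 (u : R[i]) : modc u < 1 -> 1 - u != 0.
Proof. by move=> u1; apply/eqP => /eqP; rewrite subr_eq0 => /eqP e;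
  rewrite -e modc1 ltxx in u1. Qed.

Lemma resolvent_step (d b e : R[i]) j : 1 - b * e != 0 ->
  d * e ^+ j / (1 - b * e) = d * e ^+ j + d * b * e ^+ j.+1 / (1 - b * e).
Proof. by move=> ne; rewrite exprS; field. Qed.

(* Expanding [1 / (1 - b e)] one term at a time, every term integrates to [0] and the remainder
   decays like [modc b ^+ m]. *)
Lemma Rintegral_resolvent (b c : R[i]) k : modc b < 1 ->
  mu.-integrable T (EFin \o (fun t => complex.Re (c * expi t ^+ k.+1 / (1 - b * expi t)))) /\
  \int[mu]_(t in T) complex.Re (c * expi t ^+ k.+1 / (1 - b * expi t)) = 0.
Proof.
move=> ltb1.
have nz t : 1 - b * expi t != 0 by rewrite oneB_neq0 // modcM modc_expi mulr1.
pose g (c : R[i]) (k : nat) (t : R) := complex.Re (c * expi t ^+ k / (1 - b * expi t)).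
have gc d j : continuous (g d j).
  apply: (@continuous_Re_circle R (fun w => d * w ^+ j / (1 - b * w))) => t.
  apply: cvgCM; first by apply: cvgCM; [exact: cvgC_cst|exact: cvgCX].
  apply: cvgCV => //; apply: cvgCB; first exact: cvgC_cst.
  by apply: cvgCM; [exact: cvgC_cst|exact: cvgC_id].
have gi d j := continuous_integrable (gc d j).
have ci d j : mu.-integrable T (EFin \o (fun t => complex.Re (d * expi t ^+ j))).
  apply: continuous_integrable; apply: (@continuous_Re_circle R (fun w => d * w ^+ j)) => t.
  by apply: cvgCM; [exact: cvgC_cst|exact: cvgCX].
split; first exact: gi.
rewrite -/(g c k.+1).
have rec d j : \int[mu]_(t in T) g d j.+1 t = \int[mu]_(t in T) g (d * b) j.+2 t.
  rewrite -[RHS]add0r -(Rintegral_expi d j) -RintegralD //.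
  apply: eq_Rintegral => t _; rewrite /g -raddfD /=; congr complex.Re.
  exact: resolvent_step.
have recm m d j : \int[mu]_(t in T) g d j.+1 t = \int[mu]_(t in T) g (d * b ^+ m) (j + m).+1 t.
  elim: m d j => [|m IH] d j; first by rewrite expr0 mulr1 addn0.
  by rewrite IH rec -mulrA -exprSr addnS.
have bd d j : `|\int[mu]_(t in T) g d j t| <= modc d / (1 - modc b) * (pi *+ 2).
  apply: le_trans (le_normr_Rintegral _ _) _ => //.
  have -> : modc d / (1 - modc b) * (pi *+ 2) = \int[mu]_(t in T) (modc d / (1 - modc b)).
    by rewrite Rintegral_cst //; congr (_ * _); exact: (esym (congr1 fine mu_Tpar)).
  apply: le_Rintegral => //.
  - by apply: continuous_integrable => t; apply: continuous_comp;
    [exact: gc|exact: norm_continuous].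
  - exact: cst_integrable.
  move=> t _; apply: le_trans (Re_le_modc _) _.
  rewrite modcM modcV modcM modcX modc_expi expr1n mulr1 ler_wpM2l ?modc_ge0 //.
  rewrite lef_pV2 ?posrE ?subr_gt0 //.
    by apply: le_trans (modcB_ge _ _); rewrite modc1 modcM modc_expi mulr1.
  by rewrite modc_gt0 nz.
apply/eqP; rewrite -normr_le0.
apply: (@geometric_le0 _ (modc c / (1 - modc b) * (pi *+ 2)) (modc b)).
  by rewrite modc_ge0.
move=> m; rewrite (recm m); apply: le_trans (bd _ _) _.
by rewrite modcM modcX le_eqVlt; apply/orP; left; apply/eqP; ring.
Qed.

Lemma continuous_Re_expi (c : R[i]) n : continuous (fun t : R => complex.Re (c * expi t ^+ n)).
Proof.
apply: (@continuous_Re_circle R (fun w => c * w ^+ n)) => t.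
by apply: cvgCM; [exact: cvgC_cst|exact: cvgCX].
Qed.

Lemma Re_conjc (w : R[i]) : complex.Re w^*%C = complex.Re w.
Proof. by case: w. Qed.

Lemma conj_expi (t : R) : (expi t)^*%C = (expi t)^-1 :> R[i].
Proof.
have e0 : expi t != 0 :> R[i] by rewrite -modc_eq0 modc_expi oner_eq0.
apply: (mulfI e0); rewrite divff //.
by rewrite -sqr_normc -modcC modc_expi expr1n.
Qed.

Lemma Re_mulr (w : R[i]) (x : R) : complex.Re w * x = complex.Re (w * x%:C).
Proof. by case: w => a b /=; rewrite mulr0 subr0. Qed.

Lemma conj_quotient (e z : R[i]) : ((e + z) / (e - z))^*%C = (e^*%C + z^*%C) / (e^*%C - z^*%C).
Proof. by rewrite rmorphM /= conjc_inv rmorphB rmorphD. Qed.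

(** Meant for [z'] the conjugate of [z] and [e] on the circle, where [e^-1] is the conjugate of [e]:
    the left side is then the real part of the Herglotz kernel, and the right side is the Cauchy
    kernel plus a term with only positive powers of [e]. With [z'] left free, it is a plain field
    identity. *)
Lemma herglotz_split (F : numFieldType) (e z z' : F) : e != 0 -> e - z != 0 -> 1 - z' * e != 0 ->
  (e + z) / (e - z) / 2 + (e^-1 + z') / (e^-1 - z') / 2 = e / (e - z) + z' * e / (1 - z' * e).
Proof.
move=> e0 ez ze.
have -> : (e^-1 + z') / (e^-1 - z') = (1 + z' * e) / (1 - z' * e).
  rewrite -[in RHS](mulVf e0) -mulrDl -mulrBl.
  by rewrite -mulf_div divff // mulr1.
by field; rewrite ze ez.
Qed.

Lemma poissonC (z : Cx R) t : udisc z ->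
  (poisson z t)%:C = expi t / (expi t - z) + z^*%C * expi t / (1 - z^*%C * expi t) :> R[i].
Proof.
move=> zD; have e0 : expi t != 0 :> R[i] by rewrite -modc_eq0 modc_expi oner_eq0.
have ez : expi t - z != 0 :> R[i] by exact: expi_sub_neq0.
have ze : 1 - z^*%C * expi t != 0 :> R[i].
  by rewrite oneB_neq0 // modcM modc_expi mulr1 modcJ.
rewrite /poisson ReJ_add mulrDl (conj_quotient (expi t) z) (conj_expi t).
exact: (herglotz_split e0 ez ze).
Qed.

(** Trades one power of [e] for one power of [z], up to a monomial whose mean on the circle is
    zero. *)
Lemma mono_resolvent (F : fieldType) (d z e : F) m : e - z != 0 ->
  d * e ^+ m.+1 * (e / (e - z)) = d * e ^+ m.+1 + d * z * e ^+ m * (e / (e - z)).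
Proof. by move=> ez; rewrite exprS; field. Qed.

Lemma conj_resolvent (d z e : R[i]) :
  (d * e ^+ 1 / (1 - z^*%C * e))^*%C = d^*%C * e^*%C ^+ 1 / (1 - z * e^*%C).
Proof. by rewrite !expr1 rmorphM /= conjc_inv rmorphB rmorph1 !rmorphM /= conjcK. Qed.

Lemma cauchy_resolvent (F : fieldType) (d z e : F) : e != 0 -> e - z != 0 ->
  d * e ^+ 0 * (e / (e - z)) = d + d * z * e^-1 ^+ 1 / (1 - z * e^-1).
Proof.
move=> e0 ez; have -> : 1 - z * e^-1 = (e - z) / e by rewrite mulrBl divff.
by rewrite expr0 expr1; field; rewrite e0 ez.
Qed.

(** By [mono_resolvent] the Cauchy half of the kernel turns each power of [expi t] into a power of
    [z]. The other half, multiplied by a monomial, has only positive powers and integrates to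
    zero. *)
Lemma poisson_int_monomial (z : Cx R) (c : R[i]) n : udisc z ->
  poisson_int z (fun t => complex.Re (c * expi t ^+ n)) = complex.Re (c * (z : R[i]) ^+ n).
Proof.
move=> zD.
have zb : modc (z^*%C : R[i]) < 1 by rewrite modcJ.
have e0 t : expi t != 0 :> R[i] by rewrite -modc_eq0 modc_expi oner_eq0.
have ez t : expi t - z != 0 :> R[i] by exact: expi_sub_neq0.
pose A n (c : R[i]) t : R := complex.Re (c * expi t ^+ n * (expi t / (expi t - z))).
have Ac m d : continuous (A m d).
  apply: (@continuous_Re_circle R (fun w => d * w ^+ m * (w / (w - z)))) => t.
  apply: cvgCM; first by apply: cvgCM; [exact: cvgC_cst|exact: cvgCX].
  apply: cvgCM; first exact: cvgC_id.
  by apply: cvgCV => //; apply: cvgCB; [exact: cvgC_id|exact: cvgC_cst].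
have Ai m d := continuous_integrable (Ac m d).
have ei d m := continuous_integrable (@continuous_Re_expi d m).
have A0 d : \int[mu]_(t in T) A 0%N d t = complex.Re d * (pi *+ 2).
  have [ri r0] := Rintegral_resolvent (d * z)^*%C 0 zb.
  have -> : complex.Re d * (pi *+ 2) = \int[mu]_(t in T) (complex.Re d).
    by rewrite Rintegral_cst //; congr (_ * _); exact: (esym (congr1 fine mu_Tpar)).
  rewrite -[RHS]addr0 -r0 -RintegralD //; last exact: cst_integrable.
  apply: eq_Rintegral => t _.
  rewrite /A (cauchy_resolvent d (e0 t) (ez t)) raddfD /=; congr (_ + _).
  (* The remainder has only negative powers of [expi t]. Conjugation keeps the real part and makes
     them positive, the case that [Rintegral_resolvent] covers. *)
  rewrite -[RHS]Re_conjc; congr complex.Re.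
  by rewrite -conj_expi conj_resolvent conjcK.
have AS m d : \int[mu]_(t in T) A m.+1 d t = \int[mu]_(t in T) A m (d * z) t.
  rewrite -[RHS]add0r -(Rintegral_expi d m) -RintegralD //.
  apply: eq_Rintegral => t _; rewrite /A -raddfD /=; congr complex.Re.
  exact: mono_resolvent (ez t).
have An m d : \int[mu]_(t in T) A m d t = complex.Re (d * (z : R[i]) ^+ m) * (pi *+ 2).
  elim: m d => [|m IH] d; first by rewrite A0 mulr1.
  by rewrite AS IH -mulrA -exprS.
pose B t : R := complex.Re (c * z^*%C * expi t ^+ n.+1 / (1 - z^*%C * expi t)).
have Bi : mu.-integrable T (EFin \o B) by have [] := Rintegral_resolvent (c * z^*%C) n zb.
have B0 : \int[mu]_(t in T) B t = 0 by have [] := Rintegral_resolvent (c * z^*%C) n zb.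
have -> : poisson_int z (fun t => complex.Re (c * expi t ^+ n)) =
  (pi *+ 2)^-1 * \int[mu]_(t in T) (A n c t + B t).
  congr (_ * _); apply: eq_Rintegral => t _.
  rewrite Re_mulr poissonC // mulrDr raddfD /=; congr (_ + _).
  by rewrite /B; congr complex.Re; rewrite exprS !mulrA; congr (_ / _); rewrite -!mulrA;
    congr (_ * _); rewrite mulrCA; congr (_ * _); rewrite mulrC.
rewrite RintegralD // B0 addr0 An mulrC mulfK //.
by rewrite gt_eqF // pi2_gt0.
Qed.

Lemma poisson_int_cst (z : Cx R) (c : R) : udisc z -> poisson_int z (fun=> c) = c.
Proof.
move=> zD; have := @poisson_int_monomial z c%:C 0 zD; rewrite expr0 mulr1 /= => h; rewrite -[RHS]h.
by congr (poisson_int z _); apply/funext => t; rewrite !mulr1 mulr0 subr0.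
Qed.

(** * Mean value property of the logarithm of an affine modulus *)

Lemma ln_modc (w : R[i]) : ln (modc w) = ln (modc w ^+ 2) / 2.
Proof.
have := modc_ge0 w; rewrite le_eqVlt => /predU1P[<-|w0]; first by rewrite expr0n /= ln0 // mul0r.
by rewrite lnXn // -[ln _ *+ 2]mulr_natr mulfK // pnatr_eq0.
Qed.

Lemma geom_sumC (v : R[i]) N : 1 - v != 0 -> \sum_(k < N) v ^+ k = (1 - v ^+ N) / (1 - v).
Proof.
move=> v1; apply: (mulfI v1); rewrite mulrCA divff // mulr1.
by apply: oppr_inj; rewrite -mulNr !opprB subrX1.
Qed.

(* Mean value theorem for [s |-> ln (modc (1 - s u))] plus its truncated expansion on [0, 1]. *)
Lemma ln_taylor (u : R[i]) (r : R) N : modc u <= r -> r < 1 ->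
  `|ln (modc (1 - u)) + \sum_(k < N) complex.Re (u ^+ k.+1) / k.+1%:R| <= r ^+ N.+1 / (1 - r).
Proof.
move=> ur r1; have r0 : 0 <= r := le_trans (modc_ge0 u) ur.
pose p := complex.Re u; pose q := modc u ^+ 2.
pose D : {poly R} := 1 - (2 * p) *: 'X + q *: 'X^2.
pose Q : {poly R} := \sum_(k < N) (complex.Re (u ^+ k.+1) / k.+1%:R) *: 'X^(k.+1).
have DE s : D.[s] = modc (1 - s%:C * u) ^+ 2.
  by rewrite /D !hornerE /q !modc_sqr /p; case: (u) => a b /=; ring.
have su s : 0 <= s <= 1 -> modc (s%:C * u) <= r.
  case/andP=> s0 s1; rewrite modcM modc_real ger0_norm //.
  by apply: le_trans ur; rewrite ler_piMl ?modc_ge0.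
have nz s : 0 <= s <= 1 -> 1 - s%:C * u != 0.
  by move=> s01; rewrite oneB_neq0 // (le_lt_trans (su _ s01)).
have D0 s : 0 <= s <= 1 -> 0 < D.[s].
  by move=> s01; rewrite DE exprn_gt0 // modc_gt0 nz.
have QE s : Q^`().[s] = complex.Re (u * \sum_(k < N) (s%:C * u) ^+ k).
  rewrite /Q mulr_sumr !raddf_sum /= horner_sum; apply: eq_bigr => k _ /=.
  rewrite derivZ derivXn hornerZ hornerMn hornerXn /=.
  have k0 : k.+1%:R != 0 :> R by rewrite pnatr_eq0.
  have -> : complex.Re (u ^+ k.+1) / k.+1%:R * (s ^+ k *+ k.+1) = complex.Re (u ^+ k.+1) * s ^+ k.
    by rewrite -[_ *+ k.+1]mulr_natr; field.
  by rewrite Re_mulr exprMn exprS; congr complex.Re; rewrite rmorphXn /=; ring.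
pose phi s := ln D.[s] / 2 + Q.[s].
pose dphi s := (D^`().[s] / D.[s]) / 2 + Q^`().[s].
have dE s : 0 <= s <= 1 -> dphi s = - complex.Re (u * (s%:C * u) ^+ N / (1 - s%:C * u)).
  move=> s01; rewrite /dphi QE geom_sumC ?nz // mulrA mulrBr mulr1 mulrBl raddfB /= addrA.
  rewrite [X in X + _](_ : _ = 0) ?add0r //.
  have -> : D^`().[s] = 2 * (q * s - p).
    rewrite /D derivD derivB derivZ derivZ derivX derivXn -[1]/(1%:P) derivC.
    rewrite !(hornerD, hornerN, hornerZ, hornerC, hornerMn, hornerX).
    by rewrite -mulr_natr; ring.
  rewrite DE /q !modc_sqr /p; move: (D0 s s01); rewrite DE modc_sqr.
  case: (u) => a b /=; rewrite !(mul0r, subr0, addr0, add0r, oppr0) => Dp.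
  by field; rewrite gt_eqF.
have dphiP s : 0 <= s <= 1 -> is_derive (s : R) 1 phi (dphi s).
  move=> s01.
  have h : is_derive (s : R) 1 (fun s : R => ln D.[s]) (D.[s]^-1 * D^`().[s]).
    exact: (@is_derive1_comp _ _ _ _ _ _ (is_derive1_ln (D0 s s01)) (is_derive_poly D s)).
  by rewrite /phi; apply: is_derive_eq; rewrite /dphi /GRing.scale /=; ring.
have cphi : {within `[0, 1], continuous phi}.
  apply: derivable_within_continuous => s; rewrite in_itv /= => s01.
  exact: (@ex_derive _ _ _ _ _ _ _ (dphiP s s01)).
have o01 (s : R) : s \in `]0, 1[ -> 0 <= s <= 1.
  by rewrite in_itv /= => /andP[s0 s1]; rewrite !ltW.
have [c c01] := @MVT _ phi dphi 0 1 ltr01 (fun s s01 => dphiP s (o01 s s01)) cphi.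
have p0 : phi 0 = 0.
  rewrite /phi DE mul0r subr0 modc1 expr1n ln1 mul0r add0r /Q horner_sum big1 // => k _.
  by rewrite hornerZ hornerXn expr0n mulr0.
have p1 : phi 1 = ln (modc (1 - u)) + \sum_(k < N) complex.Re (u ^+ k.+1) / k.+1%:R.
  rewrite /phi DE mul1r -ln_modc; congr (_ + _).
  by rewrite /Q horner_sum; apply: eq_bigr => k _; rewrite hornerZ hornerXn expr1n mulr1.
rewrite p0 p1 !subr0 mulr1 => ->.
have c01' := o01 c c01.
rewrite dE // normrN; apply: le_trans (Re_le_modc _) _.
rewrite !modcM modcV modcX exprS.
apply: ler_pM; rewrite ?mulr_ge0 ?invr_ge0 ?exprn_ge0 ?modc_ge0 //.
  by rewrite ler_pM ?exprn_ge0 ?modc_ge0 // lerXn2r ?nnegrE ?modc_ge0 // su.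
rewrite lef_pV2 ?posrE ?subr_gt0 //.
  by apply: le_trans (modcB_ge _ _); rewrite modc1 lerB // su.
by rewrite modc_gt0 nz.
Qed.

Lemma modc_cvg (w : Cx R) : modc v @[v --> w] --> modc w.
Proof.
apply/(@cvgrPdist_lt _ R^o _ _ (nbhs_filter w)) => e e0.
have := near_modc w e0; apply: filterS => v.
apply: le_lt_trans; rewrite distrC ler_norml modcB_ge andbT.
by rewrite lerNl opprB -(modcN (v - w)) opprB modcB_ge.
Qed.

Lemma continuous_modc_circle (a : R[i]) : continuous (fun t : R => modc (1 - a * expi t)).
Proof.
move=> t.
have h : (1 - a * expi s : Cx R) @[s --> t] --> (1 - a * expi t : Cx R).
  apply: (cvg_comp (@expi R) (fun e : Cx R => 1 - a * e : Cx R) (@expi_cvg R t)).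
  apply: cvgCB; first exact: cvgC_cst.
  by apply: cvgCM; [exact: cvgC_cst|exact: cvgC_id].
exact: cvg_comp h (@modc_cvg _).
Qed.

Lemma continuous_ln_modc (a : R[i]) : modc a < 1 ->
  continuous (fun t : R => ln (modc (1 - a * expi t))).
Proof.
move=> a1 t.
apply: (@continuous_comp R R R (fun t => modc (1 - a * expi t)) (@ln R));
  first exact: continuous_modc_circle.
apply: continuous_ln; rewrite modc_gt0 oneB_neq0 //.
by rewrite modcM modc_expi mulr1.
Qed.

Lemma geometric_eq0 (x C r : R) : 0 <= r < 1 -> (forall m, `|x| <= C * r ^+ m) -> x = 0.
Proof. by move=> r01 h; apply/eqP; rewrite -normr_le0; exact: (geometric_le0 r01 h). Qed.

Lemma le_norm_poisson_int (z : Cx R) (f : R -> R) (d : R) : udisc z ->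
  mu.-integrable T (EFin \o f) ->
  (forall t, `|f t| <= d) -> `|poisson_int z f| <= d.
Proof.
move=> zD fi fd; rewrite ler_norml; apply/andP; split.
  rewrite -[- d](poisson_int_cst _ zD); apply: le_poisson_int => //; first exact: cst_integrable.
  by move=> t _; move: (fd t); rewrite ler_norml => /andP[].
rewrite -[d](poisson_int_cst _ zD); apply: le_poisson_int => //; first exact: cst_integrable.
by move=> t _; move: (fd t); rewrite ler_norml => /andP[].
Qed.

(** The truncated expansion is a combination of monomials, hence reproduced exactly. By [ln_taylor]
    the truncation error has the same geometric bound on the circle and at [z], so the two sides
    differ by arbitrarily little. *)
Lemma poisson_int_lnBM (a : R[i]) (z : Cx R) : modc a < 1 -> udisc z ->
  poisson_int z (fun t => ln (modc (1 - a * expi t))) = ln (modc (1 - a * (z : R[i]))).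
Proof.
move=> a1 zD; set f := fun t : R => _.
have fi : mu.-integrable T (EFin \o f) := continuous_integrable (continuous_ln_modc a1).
pose S N t : R := \sum_(k < N) (k.+1%:R)^-1 * complex.Re (a ^+ k.+1 * expi t ^+ k.+1).
have SE N : mu.-integrable T (EFin \o S N) /\
    poisson_int z (S N) = \sum_(k < N) complex.Re ((a * (z : R[i])) ^+ k.+1) / k.+1%:R.
  elim: N => [|N [IH1 IH2]].
    have -> : S 0%N = fun=> 0 by apply/funext => t; rewrite /S big_ord0.
    by rewrite big_ord0 poisson_int_cst //; split => //; exact: cst_integrable.
  have -> : S N.+1 = fun t => S N t + (N.+1%:R)^-1 * complex.Re (a ^+ N.+1 * expi t ^+ N.+1).
    by apply/funext => t; rewrite /S big_ord_recr.
  have ei := continuous_integrable (@continuous_Re_expi (a ^+ N.+1) N.+1).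
  split; first by apply: integrableDR => //; exact: integrableZ.
  rewrite poisson_intD //; last exact: integrableZ.
  by rewrite poisson_intZ // poisson_int_monomial // IH2 big_ord_recr /= exprMn; congr (_ + _);
    rewrite mulrC.
have az : modc (a * (z : R[i])) <= modc a by rewrite modcM ler_piMr ?modc_ge0 // ltW.
apply/eqP; rewrite -subr_eq0; apply/eqP.
apply: (@geometric_eq0 _ (2 * (modc a / (1 - modc a))) (modc a)); first by rewrite modc_ge0.
move=> N; have [Si SN] := SE N.
have e1 : `|poisson_int z (fun t => f t + S N t)| <= modc a ^+ N.+1 / (1 - modc a).
  apply: le_norm_poisson_int => //; first exact: integrableDR.
  move=> t; have := @ln_taylor (a * expi t) (modc a) N.
  rewrite modcM modc_expi mulr1 lexx => /(_ isT a1); congr (`| _ + _ | <= _).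
  by apply: eq_bigr => k _; rewrite exprMn mulrC.
have e2 := ln_taylor N az a1.
move: e1; rewrite poisson_intD // SN => e1.
rewrite (_ : _ - _ = (poisson_int z f + \sum_(k < N) complex.Re ((a * (z : R[i])) ^+ k.+1) /
  k.+1%:R) - (ln (modc (1 - a * (z : R[i]))) +
    \sum_(k < N) complex.Re ((a * (z : R[i])) ^+ k.+1) / k.+1%:R)); last by ring.
apply: le_trans (ler_normB _ _) _.
by apply: le_trans (lerD e1 e2) _; rewrite exprS le_eqVlt; apply/orP; left; apply/eqP; ring.
Qed.

End poisson_integral.

#[local] Hint Resolve measurable_Tpar : core.

(** * Jensen's formula on the circle *)

Section jensen.
Variable R : realType.

Notation mu := (@lebesgue_measure R).
Notation T := (@Tpar R).

Lemma EFin_poisson_int (z : Cx R) (g : R -> R) : udisc z -> mu.-integrable T (EFin \o g) ->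
  (\int[mu]_(t in T) (g t * poisson z t)%:E)%E = (pi *+ 2 * poisson_int z g)%:E.
Proof.
move=> zD gi; have hP := integrable_poisson zD gi.
rewrite /poisson_int mulVKf; last by rewrite gt_eqF // pi2_gt0.
rewrite /Rintegral fineK //.
by apply: integrable_fin_num => //; exact: measurable_Tpar.
Qed.

Let radius (n : nat) : R := 1 - (n.+2%:R)^-1.

Lemma radius01 n : 0 < radius n < 1.
Proof.
rewrite /radius subr_gt0 gtrBl invr_gt0 ltr0n andbT.
by rewrite invf_lt1 ?ltr0n // ltr1n.
Qed.

Lemma modc_radius n : modc ((radius n)%:C : R[i]) < 1.
Proof.
have /andP[r0 r1] := radius01 n.
by rewrite modc_real gtr0_norm.
Qed.

Lemma cvg_radius : radius @ \oo --> (1 : R).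
Proof.
rewrite -[X in _ --> X]subr0; apply: cvgB; first exact: cvg_cst.
by have := @cvg_harmonic R; rewrite -cvg_shiftS.
Qed.

Lemma cvg_ln_modc_radius (w : R[i]) : 1 - w != 0 ->
  ln (modc (1 - (radius n)%:C * w)) @[n --> \oo] --> ln (modc (1 - w)).
Proof.
move=> w1.
pose D : {poly R} := 1 - (2 * complex.Re w) *: 'X + (modc w ^+ 2) *: 'X^2.
have DE s : D.[s] = modc (1 - s%:C * w) ^+ 2.
  by rewrite /D !hornerE !modc_sqr; case: (w) => a b /=; ring.
have E s : ln (modc (1 - s%:C * w)) = ln D.[s] / 2 by rewrite DE -ln_modc.
rewrite -[in X in _ --> X](mul1r w) E; under eq_fun do rewrite E.
apply: cvgM; last exact: cvg_cst.
apply: (cvg_comp (fun n => D.[radius n]) (@ln R)).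
  by apply: (cvg_comp radius (horner D) cvg_radius); exact: continuous_horner.
by apply: continuous_ln; rewrite DE mul1r exprn_gt0 // modc_gt0.
Qed.

Lemma expi_neq1 (t : R) : 0 < t < pi *+ 2 -> 1 - expi t != 0 :> R[i].
Proof.
move=> /andP[t0 t2]; apply/eqP => /eqP; rewrite subr_eq0 => /eqP /(congr1 (@complex.Re R)) /= c1.
have : 0 < sin (t / 2).
  by apply: sin_gt0_pi; rewrite ?divr_gt0 // ltr_pdivrMr // mulr_natr.
have h2' := cos_mulr2n (t / 2); rewrite -[_ *+ 2 in LHS]mulr_natr divfK ?pnatr_eq0 // -c1 in h2';
  move=> h2.
have h3 := cos2Dsin2 (t / 2); rewrite -mulr_natr in h2'.
by have := exprn_gt0 2 h2; lra.
Qed.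

Notation T0 := (`]0, pi *+ 2[%classic : set R).
Let f (t : R) := ln (modc (1 - expi t : R[i])).
Let g (n : nat) (t : R) := ln (modc (1 - (radius n)%:C * expi t)).

Lemma T0_sub : T0 `<=` T.
Proof. by apply: subset_itvr; rewrite bnd_simp. Qed.

Lemma poisson_int_lnB1r n z : udisc z ->
  mu.-integrable T (EFin \o g n) /\ poisson_int z (g n) =
    ln (modc (1 - (radius n)%:C * (z : R[i]))).
Proof.
move=> zD; split; last exact: poisson_int_lnBM (modc_radius n) zD.
exact: continuous_integrable (continuous_ln_modc (modc_radius n)).
Qed.

Lemma lnB1r_le n t : g n t <= ln 2.
Proof.
rewrite /g ler_ln ?posrE //.
  apply: le_trans (modcD _ _) _; rewrite modcN modc1 modcM modc_expi mulr1.
  by rewrite -[2]/(1 + 1) lerD2l ltW // modc_radius.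
by rewrite modc_gt0 oneB_neq0 // modcM modc_expi mulr1 modc_radius.
Qed.

Lemma measurable_lnB1 : measurable_fun setT f.
Proof.
apply: (measurableT_comp (@measurable_ln R)).
apply: continuous_measurable_fun.
have := @continuous_modc_circle R 1.
by rewrite (_ : (fun t : R => modc (1 - 1 * expi t)) = (fun t => modc (1 - expi t))) //;
  apply/funext => t; rewrite mul1r.
Qed.

Lemma lnB1_le t : f t <= ln 2.
Proof.
rewrite /f; have := modc_ge0 (1 - expi t : R[i]); rewrite le_eqVlt => /predU1P[<-|h].
  by rewrite ln0 // ln_ge0 // ler1n.
rewrite ler_ln ?posrE //.
by apply: le_trans (modcD _ _) _; rewrite modcN modc1 modc_expi.
Qed.

Lemma one_sub_neq0 (z : Cx R) : udisc z -> 1 - z != 0 :> R[i].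
Proof. by move=> zD; exact: oneB_neq0. Qed.

(** Here the zero of [1 - z] lies on the circle, out of reach of a uniform expansion. The radial
    functions are known exactly and stay below [ln 2], so Fatou's lemma applies to the nonnegative
    differences. At [t = 0] they do not tend to [ln 0 = 0], whence the open interval. *)
Lemma fatou_bound (z : Cx R) : udisc z ->
  (\int[mu]_(t in T0) ((ln 2 - f t) * poisson z t)%:E <=
    ((pi *+ 2) * (ln 2 - ln (modc (1 - (z : R[i])))))%:E)%E.
Proof.
move=> zD.
pose F n t := ((ln 2 - g n t) * poisson z t)%:E.
have gi n : mu.-integrable T (EFin \o (fun t => ln 2 - g n t)).
  have [h _] := poisson_int_lnB1r n zD.
  have := integrableDR (cst_integrable (ln 2)) (integrableZ (-1) h).
  by under [X in _ -> mu.-integrable _ (EFin \o X)]eq_fun do rewrite -mulN1r.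
have Fi n : mu.-integrable T (F n) := integrable_poisson zD (gi n).
have mF n : measurable_fun T0 (F n).
  apply: (measurable_int mu); apply: (@integrableS _ _ _ mu T).
  - exact: measurable_Tpar.
  - exact: measurable_itv.
  - exact: T0_sub.
  - exact: Fi.
have F0 n t : T0 t -> (0 <= F n t)%E.
  by move=> _; rewrite lee_fin mulr_ge0 ?poisson_ge0 // subr_ge0 lnB1r_le.
have := fatou mu (measurable_itv _) mF F0.
have IF n : (\int[mu]_(t in T0) F n t)%E =
  ((pi *+ 2) * (ln 2 - ln (modc (1 - (radius n)%:C * (z : R[i])))))%:E.
  have [h1 h2] := poisson_int_lnB1r n zD.
  rewrite integral_itv_obnd_cbnd; last exact: mF.
  rewrite (EFin_poisson_int zD (gi n)); congr ((_ * _)%:E).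
  have : poisson_int z (fun t => ln 2 - g n t) = ln 2 - ln (modc (1 - (radius n)%:C * (z : R[i]))).
    rewrite -h2 -[in RHS](poisson_int_cst (ln 2) zD) -mulN1r -poisson_intZ // -poisson_intD //;
      [|exact: cst_integrable|exact: integrableZ].
    by congr (poisson_int z _); apply/funext => t; rewrite mulN1r.
  by move=> <-.
have c1 : (\int[mu]_(t in T0) F n t)%E @[n --> \oo] -->
  ((pi *+ 2) * (ln 2 - ln (modc (1 - (z : R[i])))))%:E.
  under eq_fun do rewrite IF.
  apply: cvg_EFin; first exact: nearW.
  apply: cvgM; first exact: cvg_cst.
  apply: cvgB; first exact: cvg_cst.
  exact: cvg_ln_modc_radius (one_sub_neq0 zD).
rewrite (cvg_limn_einf_sup c1).1; apply: le_trans.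
rewrite le_eqVlt; apply/orP; left; apply/eqP; apply: eq_integral => t.
rewrite inE /= in_itv /= => t0.
have c2 : F n t @[n --> \oo] --> ((ln 2 - f t) * poisson z t)%:E.
  apply: cvg_EFin; first exact: nearW.
  apply: cvgM; last exact: cvg_cst.
  apply: cvgB; first exact: cvg_cst.
  exact: cvg_ln_modc_radius (expi_neq1 t0).
by rewrite (cvg_limn_einf_sup c2).1.
Qed.

(** At the centre the Poisson kernel is [1], so the Fatou bound is already the finiteness of the
    integral. *)
Lemma integrable_lnB1 : mu.-integrable T (EFin \o f).
Proof.
have z0 : udisc (0 : Cx R) by rewrite /udisc /= modc0.
have := fatou_bound z0.
have P1 t : poisson (0 : Cx R) t = 1 by rewrite poissonE modc0 expr0n subr0 subr0 modc_expi expr1n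
  divr1.
under eq_integral do rewrite P1 mulr1.
rewrite integral_itv_obnd_cbnd; last first.
  apply: measurable_funTS; apply/measurable_EFinP; apply: measurable_funB => //;
    exact: measurable_lnB1.
move=> h.
have hi : mu.-integrable T (EFin \o (fun t => ln 2 - f t)).
  apply/integrableP; split.
    apply: measurable_funTS; apply/measurable_EFinP; apply: measurable_funB => //;
      exact: measurable_lnB1.
  apply: le_lt_trans (ltry (pi *+ 2 * (ln 2 - ln (modc (1 - 0 : R[i]))))).
  apply: le_trans h.
  rewrite le_eqVlt; apply/orP; left; apply/eqP; apply: eq_integral => t _ /=.
  by rewrite ger0_norm // subr_ge0 lnB1_le.
have := integrableDR (cst_integrable (ln 2)) (integrableZ (-1) hi).
congr (_.-integrable _ _); apply/funext => t /=.
by rewrite mulN1r opprB addrC subrK.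
Qed.

Lemma le_of_sqr (x y : R) : 0 <= y -> x ^+ 2 <= y ^+ 2 -> x <= y.
Proof. by move=> y0 h; rewrite leNgt; apply/negP => yx; nra. Qed.

(* [|1 - e| <= 2 / (1 + r) * |1 - r e|] for [|e| = 1], with [e = c + i s]. *)
Lemma radius_modc_sqr_le (r c s : R) : 0 < r < 1 -> c ^+ 2 + s ^+ 2 = 1 ->
  (1 - c) ^+ 2 + s ^+ 2 <= (2 / (1 + r)) ^+ 2 * ((1 - r * c) ^+ 2 + (r * s) ^+ 2).
Proof.
move=> /andP[r0 r1] cs.
have r2 : 0 < 1 + r by lra.
rewrite exprMn exprVn mulrAC ler_pdivlMr ?exprn_gt0 //.
rewrite -subr_ge0.
have -> : 2 ^+ 2 * ((1 - r * c) ^+ 2 + (r * s) ^+ 2) - ((1 - c) ^+ 2 + s ^+ 2) * (1 + r) ^+ 2 =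
   4 * (1 - 2 * r * c + r ^+ 2 * (c ^+ 2 + s ^+ 2)) - (1 - 2 * c + (c ^+ 2 + s ^+ 2)) * (1 + r) ^+
     2 by ring.
rewrite cs.
have -> : 4 * (1 - 2 * r * c + r ^+ 2 * 1) - (1 - 2 * c + 1) * (1 + r) ^+ 2 =
  2 * (1 - r) ^+ 2 * (1 + c) by ring.
have c1 : 0 <= 1 + c by have := sqr_ge0 s; nra.
by rewrite !mulr_ge0 // subr_ge0 ltW.
Qed.

(** Fatou's lemma gives one inequality. The other follows from a pointwise domination by the radial
    functions, whose factor [2 / (1 + r)] is attained at the point [-1] and tends to [1]. *)
Lemma poisson_int_lnB1 (z : Cx R) : udisc z -> poisson_int z f = ln (modc (1 - (z : R[i]))).
Proof.
move=> zD; apply/eqP; rewrite eq_le; apply/andP; split; last first.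
  have := fatou_bound zD.
  pose h t : R := ln 2 + -1 * f t.
  have hi : mu.-integrable T (EFin \o h) by apply: integrableDR;
    [exact: cst_integrable|apply: integrableZ; exact: integrable_lnB1].
  have hP := integrable_poisson zD hi.
  have -> : (\int[mu]_(t in T0) ((ln 2 - f t) * poisson z t)%:E)%E = (pi *+ 2 * poisson_int z h)%:E.
    rewrite -(EFin_poisson_int zD hi).
    rewrite integral_itv_obnd_cbnd.
      by apply: eq_integral => t _; rewrite /h mulN1r.
    have -> : (fun t => ((ln 2 - f t) * poisson z t)%:E) = EFin \o (fun t => h t * poisson z t).
      by apply/funext => t /=; rewrite /h mulN1r.
    apply: (measurable_int mu); apply: (@integrableS _ _ _ mu T).
    - exact: measurable_Tpar.
    - exact: measurable_itv.
    - exact: T0_sub.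
    - exact: hP.
  rewrite lee_fin ler_pM2l ?pi2_gt0 // /h poisson_intD //.
  - rewrite poisson_int_cst // poisson_intZ //; last exact: integrable_lnB1.
    by rewrite mulN1r lerD2l lerN2.
  - exact: cst_integrable.
  - by apply: integrableZ; exact: integrable_lnB1.
have key n : poisson_int z f <= ln (2 / (1 + radius n)) +
  ln (modc (1 - (radius n)%:C * (z : R[i]))).
  have [gi <-] := poisson_int_lnB1r n zD.
  rewrite -[X in X + _](poisson_int_cst _ zD) -poisson_intD //; last exact: cst_integrable.
  apply: le_poisson_int => //; first exact: integrable_lnB1.
    by apply: integrableDR => //; exact: cst_integrable.
  move=> t t0; have r01 := radius01 n; have r2 : 0 < 1 + radius n by lra.
  have g0 : 0 < modc (1 - (radius n)%:C * expi t).
    by rewrite modc_gt0 oneB_neq0 // modcM modc_expi mulr1 modc_radius.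
  have f0 : 0 < modc (1 - expi t : R[i]) by rewrite modc_gt0 expi_neq1.
  have k0 : 0 < 2 / (1 + radius n) by rewrite divr_gt0.
  have kg : 0 < 2 / (1 + radius n) * modc (1 - (radius n)%:C * expi t) by exact: mulr_gt0.
  rewrite /f /g -lnM ?posrE // ler_ln ?posrE //.
  suff h : modc (1 - expi t : R[i]) ^+ 2 <=
    (2 / (1 + radius n) * modc (1 - (radius n)%:C * expi t)) ^+ 2.
    by apply: (le_of_sqr (ltW kg)).
  rewrite exprMn !modc_sqr /=.
  have := radius_modc_sqr_le r01 (cos2Dsin2 t).
  by rewrite !(mul0r, subr0, addr0, sub0r, sqrrN).
have c : (ln (2 / (1 + radius n)) + ln (modc (1 - (radius n)%:C * (z : R[i])))) @[n --> \oo] -->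
  ln (2 / (1 + 1)) + ln (modc (1 - (z : R[i]))).
  apply: cvgD; last exact: cvg_ln_modc_radius (one_sub_neq0 zD).
  have c2 : (2 / (1 + radius n)) @[n --> \oo] --> (2 / (1 + 1) : R).
    apply: cvgM; first exact: cvg_cst.
    apply: cvgV; first by rewrite gt_eqF.
    by apply: cvgD; [exact: cvg_cst|exact: cvg_radius].
  by apply: (cvg_comp _ _ c2); apply: continuous_ln; rewrite divr_gt0.
rewrite -[leRHS]add0r -ln1 -(@divff _ (1 + 1 : R)); last by rewrite gt_eqF.
by apply: (cvgr_to_ge c); apply: nearW.
Qed.

End jensen.

(** * Composition with iterated logistic maps *)

Section logistic_step.
Variable R : realType.

Implicit Types (p q : {poly R}) (r : R).

(** A submultiplicative norm that dominates the supremum on the complex disc of radius [r]: analytic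
    estimates become algebra on real coefficients. *)
Definition pnorm (r : R) (p : {poly R}) : R := \sum_(i < size p) `|p`_i| * r ^+ i.

Lemma pnormE r p n : (size p <= n)%N -> pnorm r p = \sum_(i < n) `|p`_i| * r ^+ i.
Proof.
move=> pn; rewrite /pnorm -!(big_mkord xpredT (fun i => `|p`_i| * r ^+ i)).
rewrite (big_cat_nat (leq0n _) pn) /= [X in _ = _ + X]big_nat_cond [X in _ = _ + X]big1 ?addr0 //.
by move=> i /andP[/andP[pi _] _]; rewrite nth_default // normr0 mul0r.
Qed.

Lemma pnorm_ge0 r p : 0 <= r -> 0 <= pnorm r p.
Proof. by move=> r0; apply: sumr_ge0 => i _; rewrite mulr_ge0 ?exprn_ge0. Qed.

Lemma pnormD r p q : 0 <= r -> pnorm r (p + q) <= pnorm r p + pnorm r q.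
Proof.
move=> r0; pose n := maxn (size p) (size q).
rewrite (@pnormE r (p + q) n) ?size_polyD // (@pnormE r p n) ?leq_maxl // (@pnormE r q n)
  ?leq_maxr //.
rewrite -big_split /=; apply: ler_sum => i _.
by rewrite coefD -mulrDl ler_wpM2r ?exprn_ge0 // ler_normD.
Qed.

Lemma pnormZ r c p : pnorm r (c *: p) = `|c| * pnorm r p.
Proof.
rewrite (@pnormE r (c *: p) (size p)) ?size_scale_leq // /pnorm mulr_sumr.
by apply: eq_bigr => i _; rewrite coefZ normrM mulrA.
Qed.

Lemma pnormN r p : pnorm r (- p) = pnorm r p.
Proof. by rewrite -scaleN1r pnormZ normrN1 mul1r. Qed.

Lemma pnormC r c : pnorm r c%:P = `|c|.
Proof. by rewrite (@pnormE r _ 1) ?size_polyC_leq1 // big_ord1 coefC /= mulr1. Qed.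

Lemma pnormMX r p : pnorm r (p * 'X) = r * pnorm r p.
Proof.
rewrite (@pnormE r _ (size p).+1); last first.
  by have [->|p0] := eqVneq p 0; rewrite ?mul0r ?size_poly0 // size_mulX.
rewrite big_ord_recl coefMX /= normr0 mul0r add0r /pnorm mulr_sumr.
by apply: eq_bigr => i _; rewrite coefMX /= exprS mulrCA.
Qed.

Lemma pnorm_MXC r p c : pnorm r (p * 'X + c%:P) = r * pnorm r p + `|c|.
Proof.
rewrite (@pnormE r _ (size p).+1); last first.
  apply: leq_trans (size_polyD _ _) _; rewrite geq_max (leq_trans (size_polyC_leq1 _)) // andbT.
  by have [->|p0] := eqVneq p 0; rewrite ?mul0r ?size_poly0 // size_mulX.
rewrite big_ord_recl coefD coefMX coefC /= add0r mulr1 addrC; congr (_ + _).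
rewrite mulr_sumr; apply: eq_bigr => i _.
by rewrite coefD coefMX coefC /= addr0 exprS mulrCA.
Qed.

Lemma pnormM r p q : 0 <= r -> pnorm r (p * q) <= pnorm r p * pnorm r q.
Proof.
move=> r0; elim/poly_ind: p => [|p c IH]; first by rewrite mul0r -[0]/(0%:P) pnormC normr0 mul0r.
rewrite pnorm_MXC mulrDl mul_polyC; apply: le_trans (pnormD _ _ r0) _.
rewrite mulrDl pnormZ lerD2r mulrAC pnormMX -mulrA ler_wpM2l //.
Qed.

Lemma pnormX r : pnorm r 'X = r.
Proof. by rewrite -[X in pnorm r X]mul1r pnormMX -[1]/(1%:P) pnormC normr1 mulr1. Qed.

Lemma pnorm_mono r s p : 0 <= r <= s -> pnorm r p <= pnorm s p.
Proof.
move=> /andP[r0 rs]; apply: ler_sum => i _.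
by rewrite ler_wpM2l // lerXn2r // nnegrE // (le_trans r0).
Qed.

(** Continuity of composition at ['X]. The modulus [d] is found before [s], hence before the
    parameters of the folding are fixed. *)
Lemma comp_poly_close p r e : 0 <= r -> 0 < e -> exists2 d, 0 < d &
  forall s : {poly R}, pnorm r (s - 'X) <= d -> pnorm r (p \Po s - p) <= e.
Proof.
move=> r0; elim/poly_ind: p e => [|p c IH] e e0.
  by exists 1 => // s _; rewrite comp_poly0 subr0 -[0]/(0%:P) pnormC normr0 ltW.
have A0 : 0 < r + 1 by lra.
have N0 : 0 < pnorm r p + 1 by have := pnorm_ge0 p r0; lra.
have e1 : 0 < e / 2 / (r + 1) by rewrite !divr_gt0.
have [d d0 hd] := IH _ e1.
have d2 : 0 < e / 2 / (pnorm r p + 1) by rewrite !divr_gt0.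
exists (Num.min 1 (Num.min d (e / 2 / (pnorm r p + 1)))).
  by rewrite !lt_min ltr01 d0.
move=> s; rewrite !le_min => /andP[s1 /andP[sd sd2]].
have sr : pnorm r s <= r + 1.
  rewrite -[s](subrK 'X) addrC; apply: le_trans (pnormD _ _ r0) _.
  by rewrite pnormX lerD2l.
have -> : (p * 'X + c%:P) \Po s - (p * 'X + c%:P) = (p \Po s - p) * s + p * (s - 'X).
  by rewrite comp_polyD comp_polyM comp_polyX comp_polyC; ring.
apply: le_trans (pnormD _ _ r0) _; rewrite [leRHS](splitr e).
apply: lerD; apply: le_trans (pnormM _ _ r0) _.
  have := ler_pM (pnorm_ge0 _ r0) (pnorm_ge0 _ r0) (hd s sd) sr.
  by rewrite divfK // gt_eqF.
apply: le_trans (ler_wpM2l (pnorm_ge0 _ r0) sd2) _.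
by rewrite mulrCA -[leRHS]mulr1 ler_wpM2l ?divr_ge0 ?(ltW e0) // ler_pdivrMr // mul1r lerDl.
Qed.

(** Normalised to have derivative [1] at the origin, so that it is close to ['X] there; it folds
    [[0, 4 * L]] two-to-one onto [[0, L]], with maximum at [2 * L]. *)
Definition logistic_map (L : R) : {poly R} := 'X - (4 * L)^-1 *: 'X^2.

(* [(logistic M m).[v]] is [M * l^m (v / (4 ^ m * M))] for the logistic map [l s = 4 s (1 - s)]. *)
Fixpoint logistic (M : R) (m : nat) : {poly R} :=
  if m is m'.+1 then logistic_map M \Po logistic (4 * M) m' else 'X.

(** The outer map with parameter [M] contributes at most [r ^+ 2 / M], and the parameter is
    multiplied by 4 at each level, so the sum is geometric and independent of [m]. The condition
    [r <= M] keeps the norm of the inner iterate below [2 * r]. *)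
Lemma logistic_close r M m : 0 <= r -> 0 < M -> r <= M ->
  pnorm r (logistic M m - 'X) <= 2 * r ^+ 2 / M.
Proof.
move=> r0; elim: m M => [|m IH] M M0 rM.
  by rewrite subrr -[0]/(0%:P) pnormC normr0 divr_ge0 ?mulr_ge0 ?sqr_ge0 // ltW.
have M4 : 0 < 4 * M by lra.
have rM4 : r <= 4 * M by lra.
have h := IH _ M4 rM4.
have hr : pnorm r (logistic (4 * M) m) <= 2 * r.
  rewrite -[logistic _ _](subrK 'X) addrC; apply: le_trans (pnormD _ _ r0) _.
  rewrite pnormX (_ : 2 * r = r + r); last by ring.
  rewrite lerD2l; apply: le_trans h _.
  rewrite ler_pdivrMr // expr2; nra.
rewrite /=; set S := logistic (4 * M) m in h hr *.
have -> : logistic_map M \Po S - 'X = (S - 'X) - (4 * M)^-1 *: (S * S).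
  rewrite /logistic_map comp_polyB comp_polyX comp_polyZ -['X^2]/('X * 'X) comp_polyM comp_polyX.
  by rewrite addrAC.
apply: le_trans (pnormD _ _ r0) _; rewrite pnormN pnormZ.
have h2 : `|(4 * M)^-1| * pnorm r (S * S) <= (4 * M)^-1 * (4 * r ^+ 2).
  rewrite ger0_norm ?invr_ge0 ?(ltW M4) // ler_wpM2l ?invr_ge0 ?(ltW M4) //.
  apply: le_trans (pnormM _ _ r0) _.
  have := ler_pM (pnorm_ge0 _ r0) (pnorm_ge0 _ r0) hr hr.
  by move=> /le_trans; apply; rewrite le_eqVlt; apply/orP; left; apply/eqP; ring.
apply: le_trans (lerD h h2) _.
have -> : 2 * r ^+ 2 / (4 * M) + (4 * M)^-1 * (4 * r ^+ 2) = (3 / 2) * (r ^+ 2 / M) by field;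
  rewrite gt_eqF.
have : 0 <= r ^+ 2 / M by rewrite divr_ge0 ?sqr_ge0 // ltW.
rewrite -mulrA; lra.
Qed.

Lemma logistic_mapE M v : (logistic_map M).[v] = v - v ^+ 2 / (4 * M).
Proof. by rewrite /logistic_map hornerD hornerN hornerZ hornerX hornerXn [_^-1 * _]mulrC. Qed.

Lemma logistic_range M m v : 0 < M -> 0 <= v <= 4 ^+ m * M ->
  0 <= (logistic M m).[v] <= M /\ (logistic M m).[v] <= v.
Proof.
elim: m M v => [|m IH] M v M0 vM; first by rewrite hornerX; move: vM; rewrite expr0 mul1r => ->.
have M4 : 0 < 4 * M by lra.
have [] := IH _ v M4; first by rewrite mulrA -exprSr.
rewrite /= horner_comp logistic_mapE; set w := (logistic _ _).[v] => /andP[w0 w4] wv.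
have e : w - w ^+ 2 / (4 * M) = w * (1 - w / (4 * M)) by field; rewrite gt_eqF.
have h : 0 <= w / (4 * M) <= 1 by rewrite divr_ge0 ?(ltW M4) //= ler_pdivrMr // mul1r.
split; last by rewrite e; nra.
rewrite e; apply/andP; split; first by nra.
have -> : w = (w / (4 * M)) * (4 * M) by rewrite divfK // gt_eqF.
set s := w / (4 * M) in h *.
rewrite mulfK ?gt_eqF //.
have : 0 <= (1 - 2 * s) ^+ 2 by exact: sqr_ge0.
nra.
Qed.

Definition max1norm (x : R) : R := Num.max 1 `|x|.

(* Iterates [8 * max1norm (l s) <= (8 * max1norm s) ^+ 2] for [l s = 4 s (1 - s)]. *)
Lemma logistic_growth M m v : 0 < M ->
  8 * max1norm ((logistic M m).[v] / M) <= (8 * max1norm (v / (4 ^+ m * M))) ^+ (2 ^ m).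
Proof.
elim: m M => [|m IH] M M0; first by rewrite hornerX expr0 mul1r expn0 expr1.
have M4 : 0 < 4 * M by lra.
have := IH _ M4; rewrite mulrA -exprSr.
rewrite /= horner_comp logistic_mapE; set w := (logistic _ _).[v] => h.
rewrite expnSr exprM; apply: le_trans (_ : (8 * max1norm (w / (4 * M))) ^+ 2 <= _); last first.
  by rewrite lerXn2r ?nnegrE ?mulr_ge0 ?exprn_ge0 // ?mulr_ge0 // /max1norm le_max ler01.
have -> : (w - w ^+ 2 / (4 * M)) / M = 4 * ((w / (4 * M)) - (w / (4 * M)) ^+ 2) by field;
  rewrite gt_eqF.
set s := w / (4 * M).
have b1_1 : 1 <= max1norm s by rewrite /max1norm le_max lexx.
have b1_s : `|s| <= max1norm s by rewrite /max1norm le_max lexx orbT.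
have : max1norm (4 * (s - s ^+ 2)) <= 8 * max1norm s ^+ 2.
  rewrite {1}/max1norm ge_max; apply/andP; split; first by nra.
  rewrite normrM ger0_norm //; have := ler_normB s (s ^+ 2); rewrite normrX.
  have := normr_ge0 s; nra.
move=> hb; rewrite (_ : (8 * max1norm s) ^+ 2 = 8 * (8 * max1norm s ^+ 2)); last by ring.
by rewrite ler_wpM2l.
Qed.

Lemma poly_bound p : exists2 C, 1 <= C & forall y : R, `|p.[y]| <= C * max1norm y ^+ (size p).
Proof.
exists (pnorm 1 p + 1); first by rewrite lerDr pnorm_ge0.
move=> y; rewrite horner_coef; apply: le_trans (ler_norm_sum _ _ _) _.
have b_1 : 1 <= max1norm y by rewrite /max1norm le_max lexx.
have b_y : `|y| <= max1norm y by rewrite /max1norm le_max lexx orbT.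
apply: le_trans (_ : pnorm 1 p * max1norm y ^+ size p <= _); last first.
  by rewrite ler_wpM2r ?lerDl // exprn_ge0 // (le_trans ler01).
rewrite /pnorm mulr_suml; apply: ler_sum => i _.
rewrite expr1n mulr1 normrM normrX ler_wpM2l //.
apply: le_trans (_ : max1norm y ^+ i <= _); first by rewrite lerXn2r // nnegrE // (le_trans ler01).
by rewrite ler_weXn2l // ltnW.
Qed.

Lemma pnorm_horner p (v : R) : `|p.[v]| <= pnorm `|v| p.
Proof.
rewrite horner_coef; apply: le_trans (ler_norm_sum _ _ _) _.
by apply: ler_sum => i _; rewrite normrM normrX.
Qed.

(** * Real polynomials at complex points *)

Definition evalC p (w : R[i]) : R[i] := (map_poly (real_complex R) p).[w].

Lemma evalCD p q w : evalC (p + q) w = evalC p w + evalC q w.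
Proof. by rewrite /evalC rmorphD hornerD. Qed.

Lemma evalCB p q w : evalC (p - q) w = evalC p w - evalC q w.
Proof. by rewrite /evalC rmorphB hornerD hornerN. Qed.

Lemma evalCMX p c w : evalC (p * 'X + c%:P) w = evalC p w * w + c%:C.
Proof. by rewrite /evalC rmorphD rmorphM /= map_polyX map_polyC hornerMXaddC. Qed.

Lemma evalC0 w : evalC 0 w = 0.
Proof. by rewrite /evalC rmorph0 horner0. Qed.

Lemma evalC_real p (x : R) : evalC p x%:C = (p.[x])%:C.
Proof. by rewrite /evalC horner_map. Qed.

Lemma pnorm_evalC p w : modc (evalC p w) <= pnorm (modc w) p.
Proof.
elim/poly_ind: p => [|p c IH]; first by rewrite evalC0 modc0 pnorm_ge0 ?modc_ge0.
rewrite evalCMX pnorm_MXC; apply: le_trans (modcD _ _) _.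
by rewrite modc_real lerD2r modcM mulrC ler_wpM2l ?modc_ge0.
Qed.

Lemma pnorm_deriv p w : modc (evalC p^`() w) <= pnorm (modc w + 2) p.
Proof.
have w0 := modc_ge0 w; have w2 : 0 <= modc w + 2 by rewrite addr_ge0.
elim/poly_ind: p => [|p c IH]; first by rewrite deriv0 evalC0 modc0 pnorm_ge0.
rewrite derivD derivC addr0 derivM derivX mulr1 evalCD -[_ * 'X]addr0 evalCMX addr0 pnorm_MXC.
apply: le_trans (modcD _ _) _; rewrite modcM.
have h1 : modc (evalC p w) <= pnorm (modc w + 2) p.
  by apply: le_trans (pnorm_evalC _ _) _; apply: pnorm_mono; rewrite w0 /= lerDl.
have N0 := pnorm_ge0 p w2; have c0 := normr_ge0 c.
nra.
Qed.

(** Induction along Horner's scheme replaces second derivatives: a step multiplies the old remainder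
    by [w + h], of modulus at most [modc w + 1], and adds [h ^+ 2] times the derivative, which costs
    one more copy of the norm. Together this is the radius [modc w + 2]. *)
Lemma evalC_taylor p w h : modc h <= 1 ->
  modc (evalC p (w + h) - evalC p w - h * evalC p^`() w) <= modc h ^+ 2 * pnorm (modc w + 2) p.
Proof.
move=> h1.
have w0 := modc_ge0 w; have w2 : 0 <= modc w + 2 by rewrite addr_ge0.
have h0 := modc_ge0 h.
elim/poly_ind: p => [|p c IH].
  by rewrite deriv0 !evalC0 mulr0 !subr0 modc0 mulr_ge0 ?sqr_ge0 ?pnorm_ge0.
set E := _ - _ - _ in IH.
have -> : evalC (p * 'X + c%:P) (w + h) - evalC (p * 'X + c%:P) w - h * evalC (p * 'X + c%:P)^`()
  w =
   (w + h) * E + h ^+ 2 * evalC p^`() w.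
  rewrite derivD derivC addr0 derivM derivX mulr1 !evalCMX evalCD -[p^`() * 'X]addr0 evalCMX addr0
    /E.
  by ring.
rewrite pnorm_MXC; apply: le_trans (modcD _ _) _; rewrite (modcM (w + h)) (modcM (h ^+ 2)) modcX.
have d1 := pnorm_deriv p w.
have N0 := pnorm_ge0 p w2.
have wh : modc (w + h) <= modc w + 1 by apply: le_trans (modcD _ _) _; rewrite lerD2l.
apply: le_trans (lerD (ler_pM (modc_ge0 _) (modc_ge0 _) wh IH) (ler_wpM2l (sqr_ge0 _) d1)) _.
rewrite -subr_ge0.
set N := pnorm _ _ in N0 *.
rewrite (_ : _ - _ = modc h ^+ 2 * `|c|); last by ring.
by rewrite mulr_ge0 ?sqr_ge0.
Qed.

Lemma ln2_ge : 1 / 2 <= ln 2 :> R.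
Proof.
have h : -1 < - (1 / 2) :> R by lra.
have := le_ln1Dx h; have -> : 1 + - (1 / 2) = 2^-1 :> R by lra.
by rewrite lnV ?posrE // lerN2.
Qed.

Lemma max1norm_ge1 x : 1 <= max1norm x.
Proof. by rewrite /max1norm le_max lexx. Qed.

(** The two logarithmic terms pay for two failures: beyond [a1 ^+ 4] closeness of [q] to [p] is no
    longer used and a crude power bound replaces it; beyond [a2 ^+ 2] the iterate is no longer
    confined to [[0, M]]. *)
Lemma polynomial_step p r e : (forall y, 1 <= p.[y]) -> 0 <= r -> 0 < e ->
  exists q t K1 a1 K2 a2,
  [/\ [/\ forall y, 1 <= q.[y], pnorm r (q - p) <= e & e^-1 <= t],
      [/\ 0 <= K1, 0 <= K2, 0 < a1, 0 < a2 & K1 / a1 + K2 / a2 <= e],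
      t / e <= a2, forall v, 0 <= v <= a2 ^+ 2 -> q.[v] <= t &
      forall v, 0 <= v -> ln q.[v] <= ln p.[v] + e + K1 * ln (1 + v / a1 ^+ 2) +
        K2 * ln (1 + v / a2 ^+ 2)].
Proof.
move=> p1 r0 e0.
have [C C1 hC] := poly_bound p; set D := size p in hC.
have C0 : 0 < C := lt_le_trans ltr01 C1.
have lC : 0 <= ln C by rewrite ln_ge0.
have D0 : 0 <= D%:R :> R by [].
(* Beyond [a1 ^+ 4], both [ln v] and [1] are at most [2 * ln (1 + v / a1 ^+ 2)], so [K1] times that
   logarithm covers [D * ln v + ln C]. Then [a1] makes [K1 / a1] at most [e / 2]. *)
pose K1 := 2 * D%:R + 2 * ln C.
have K10 : 0 <= K1 by rewrite /K1; lra.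
pose a1 := 1 + 2 * K1 / e.
have a11 : 1 <= a1 by rewrite lerDl divr_ge0 ?(ltW e0) // mulr_ge0.
have a10 : 0 < a1 := lt_le_trans ltr01 a11.
(* The disc of radius [r1] contains both the prescribed disc and the real segment on which [q] is
   compared with [p] directly. *)
pose r1 := r + a1 ^+ 4.
have a4 : 1 <= a1 ^+ 4 by rewrite exprn_ege1.
have r10 : 0 <= r1 by rewrite /r1; lra.
have [d d0 hd] := comp_poly_close p r10 e0.
(* One summand per requirement: [s <= s ^+ 2], [r1 <= M], the closeness [d] in [logistic_close], and
   [K2 / a2 <= e / 2]. *)
pose s := 1 + r1 + 2 * r1 ^+ 2 / d + 8 * D%:R / e.
have x1 : 0 <= 2 * r1 ^+ 2 / d by rewrite divr_ge0 ?(ltW d0) // mulr_ge0 // sqr_ge0.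
have x2 : 0 <= 8 * D%:R / e by rewrite divr_ge0 ?(ltW e0) // mulr_ge0.
have s1 : 1 <= s by rewrite /s; lra.
have s0 : 0 < s := lt_le_trans ltr01 s1.
pose M := s ^+ 2.
have sM : s <= M by rewrite /M expr2 ler_peMl // ltW.
have M0 : 0 < M by rewrite exprn_gt0.
have M1 : 1 <= M := le_trans s1 sM.
(* The first term bounds [p] on [[0, M]]; the second forces [t] to infinity as the tolerance
   shrinks. *)
pose t := C * M ^+ D + e^-1.
(* Everything else is fixed by now, and no later estimate limits [m] from above. *)
have [m hm] : exists m, t / e <= 2 ^+ m * s.
  exists (Num.bound (t / e)).
  have t0 : 0 <= t / e by rewrite divr_ge0 ?(ltW e0) // addr_ge0 ?mulr_ge0 ?exprn_ge0 ?invr_ge0 //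
    ltW.
  have h1 := archi_boundP t0; apply: le_trans (ltW h1) _.
  apply: le_trans (_ : 2 ^+ Num.bound (t / e) <= _); last by rewrite ler_peMr // exprn_ge0.
  by rewrite -natrX ler_nat ltnW // ltn_expl.
pose a2 := 2 ^+ m * s.
have p2 : 0 < 2 ^+ m :> R by rewrite exprn_gt0.
have a20 : 0 < a2 by rewrite mulr_gt0.
have VE : a2 ^+ 2 = 4 ^+ m * M by rewrite exprMn -exprM mulnC exprM (_ : 2 ^+ 2 = 4) //; ring.
pose K2 : R := 4 * D%:R * 2 ^+ m.
have K20 : 0 <= K2 by rewrite !mulr_ge0 // ltW.
pose S := logistic M m.
have r1M : r1 <= M by apply: le_trans sM; rewrite /s; lra.
have cl : pnorm r1 (p \Po S - p) <= e.
  apply: hd; apply: le_trans (logistic_close m r10 M0 r1M) _.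
  rewrite ler_pdivrMr // [d * M]mulrC -ler_pdivrMr //.
  by apply: le_trans sM; rewrite /s; lra.
have q1 y : 1 <= (p \Po S).[y] by rewrite horner_comp.
exists (p \Po S), t, K1, a1, K2, a2; split => //.
- split => //; last by rewrite lerDr mulr_ge0 ?exprn_ge0 // ltW.
  by apply: le_trans cl; apply: pnorm_mono; rewrite r0 /= /r1 lerDl; lra.
- split => //.
  rewrite [leRHS](splitr e); apply: lerD.
    rewrite ler_pdivrMr // /a1 mulrDr mulr1.
    have -> : e / 2 * (2 * K1 / e) = K1 by field; rewrite gt_eqF.
    by rewrite lerDr divr_ge0 // ltW.
  rewrite /K2 /a2 (_ : _ / _ = 4 * D%:R / s); last by field; rewrite !gt_eqF.
  rewrite ler_pdivrMr //.
  have -> : 4 * D%:R = e / 2 * (8 * D%:R / e) by field; rewrite gt_eqF.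
  by rewrite ler_wpM2l ?divr_ge0 ?(ltW e0) // /s; lra.
- move=> v; rewrite VE => hv; have [/andP[S0 SM] Sv] := logistic_range M0 hv.
  rewrite horner_comp; apply: le_trans (ler_norm _) _; apply: le_trans (hC _) _.
  rewrite /t -[leLHS]addr0 lerD ?invr_ge0 ?(ltW e0) // ler_wpM2l ?(ltW C0) //.
  by rewrite lerXn2r ?nnegrE ?(le_trans ler01 (max1norm_ge1 _)) ?(ltW M0) // /max1norm ge_max M1
    ger0_norm.
move=> v v0.
have l1 : 0 <= ln (1 + v / a1 ^+ 2) by rewrite ln_ge0 // lerDl divr_ge0 // sqr_ge0.
have l2 : 0 <= ln (1 + v / a2 ^+ 2) by rewrite ln_ge0 // lerDl divr_ge0 // sqr_ge0.
have p0 : 0 < p.[v] := lt_le_trans ltr01 (p1 v).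
have q0 : 0 < (p \Po S).[v] := lt_le_trans ltr01 (q1 v).
(* The fourth power is chosen so that, above it, [x = v / a1 ^+ 2] is at least [a1 ^+ 2]; hence
   [v <= x ^+ 2] and [ln v] is controlled by [ln (1 + x)]. *)
have [vr|rv] := leP v (a1 ^+ 4).
  suff : ln (p \Po S).[v] <= ln p.[v] + e.
    by have := mulr_ge0 K10 l1; have := mulr_ge0 K20 l2; lra.
  have h : (p \Po S).[v] <= p.[v] + e.
    rewrite -lerBlDl -hornerN -hornerD.
    apply: le_trans (ler_norm _) _; apply: le_trans (pnorm_horner _ _) _.
    apply: le_trans cl; apply: pnorm_mono; rewrite ger0_norm // v0 /=.
    by apply: le_trans vr _; rewrite /r1 lerDr.
  apply: le_trans (_ : ln (p.[v] + e) <= _); first by rewrite ler_ln ?posrE // addr_gt0.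
  have -> : p.[v] + e = p.[v] * (1 + e / p.[v]) by field; rewrite gt_eqF.
  have ep : 0 < e / p.[v] by rewrite divr_gt0.
  rewrite lnM ?posrE ?addr_gt0 // lerD2l.
  apply: le_trans (le_ln1Dx _) _; first by lra.
  by rewrite ler_pdivrMr // ler_peMr // ltW.
have v1 : 1 <= v by lra.
have v0' : 0 < v by lra.
have V0 : 0 < a2 ^+ 2 by rewrite exprn_gt0.
set y := v / a2 ^+ 2 in l2 *.
have y0 : 0 < y by rewrite divr_gt0.
(* Up to [a2 ^+ 2] the iterate is at most [v]. Beyond, [logistic_growth] gives the power [2 ^ m] of
   [8 * y], and [8 * y <= (1 + y) ^+ 4] for [y >= 1]; this exponent 4 is the 4 in [K2]. *)
have Sb : max1norm S.[v] <= v * (1 + y) ^+ (4 * 2 ^ m).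
  have [vV|Vv] := leP v (a2 ^+ 2).
    have hv : 0 <= v <= 4 ^+ m * M by rewrite v0 -VE.
    have [/andP[S0 SM] Sv] := logistic_range M0 hv.
    apply: le_trans (_ : v <= _); last by rewrite ler_peMr // exprn_ege1 // lerDl ltW.
    by rewrite /max1norm ge_max v1 ger0_norm.
  have h := logistic_growth m v M0; rewrite -VE -/y -/S in h.
  have y1 : 1 <= y by rewrite ler_pdivlMr // mul1r ltW.
  have by1 : max1norm y = y by rewrite /max1norm ger0_norm ?(ltW y0) //; apply/max_idPr.
  rewrite by1 in h.
  have h8 : (8 * y) ^+ (2 ^ m) <= (1 + y) ^+ (4 * 2 ^ m).
    have y8 : 0 <= 8 * y by rewrite mulr_ge0 // ltW.
    have yy : 0 <= (1 + y) ^+ 4 by rewrite exprn_ge0 // addr_ge0 // ltW.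
    rewrite exprM lerXn2r //.
    have -> : (1 + y) ^+ 4 = ((1 - y) ^+ 2 + 4 * y) ^+ 2 by ring.
    have := sqr_ge0 (1 - y); nra.
  have bM : max1norm S.[v] <= M * max1norm (S.[v] / M).
    rewrite {1}/max1norm ge_max; apply/andP; split.
      by apply: le_trans M1 _; rewrite ler_peMr ?max1norm_ge1 // ltW.
    have Mn : M != 0 by rewrite gt_eqF.
    rewrite -{1}[S.[v]](divfK Mn) normrM mulrC (gtr0_norm M0).
    by rewrite ler_wpM2l ?(ltW M0) // /max1norm le_max lexx orbT.
  have MV : M <= v.
    by apply: le_trans (ltW Vv); rewrite VE ler_peMl ?(ltW M0) // exprn_ege1 // ler1n.
  apply: le_trans bM _; apply: ler_pM => //; first exact: ltW.
    exact: le_trans ler01 (max1norm_ge1 _).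
  by have := max1norm_ge1 (S.[v] / M); lra.
have b0 : 0 < max1norm S.[v] := lt_le_trans ltr01 (max1norm_ge1 _).
have lb : ln (max1norm S.[v]) <= ln v + (4 * 2 ^ m)%:R * ln (1 + y).
  have y10 : 0 < 1 + y by rewrite addr_gt0.
  have -> : ln v + (4 * 2 ^ m)%:R * ln (1 + y) = ln (v * (1 + y) ^+ (4 * 2 ^ m)).
    by rewrite lnM ?posrE ?exprn_gt0 // lnXn // mulr_natl.
  by rewrite ler_ln ?posrE // mulr_gt0 // exprn_gt0.
have lq : ln (p \Po S).[v] <= ln C + D%:R * ln (max1norm S.[v]).
  have -> : ln C + D%:R * ln (max1norm S.[v]) = ln (C * max1norm S.[v] ^+ D).
    by rewrite lnM ?posrE ?exprn_gt0 // lnXn // mulr_natl.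
  rewrite ler_ln ?posrE ?mulr_gt0 ?exprn_gt0 // horner_comp.
  by apply: le_trans (ler_norm _) (hC _).
set x := v / a1 ^+ 2 in l1 *.
have a12 : 0 < a1 ^+ 2 by rewrite exprn_gt0.
have x0 : 0 < x by rewrite divr_gt0.
have x1' : 1 <= x.
  rewrite ler_pdivlMr // mul1r; apply: le_trans (ltW rv).
  by rewrite ler_weXn2l.
have lv : ln v <= 2 * ln (1 + x).
  have -> : 2 * ln (1 + x) = ln ((1 + x) ^+ 2) by rewrite lnXn ?addr_gt0 // mulr_natl.
  rewrite ler_ln ?posrE ?exprn_gt0 ?addr_gt0 //.
  have vx : v = x * a1 ^+ 2 by rewrite divfK // gt_eqF.
  have ax : a1 ^+ 2 <= x by rewrite ler_pdivlMr // -exprD ltW.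
  rewrite vx; nra.
have lx : 1 / 2 <= ln (1 + x).
  apply: le_trans ln2_ge _; rewrite ler_ln ?posrE ?addr_gt0 //; lra.
have lp : 0 <= ln p.[v] by rewrite ln_ge0.
have hC2 : ln C <= 2 * ln C * ln (1 + x) by nra.
have hD1 := ler_wpM2l D0 lb.
have hD2 := ler_wpM2l D0 lv.
rewrite mulrDr natrM natrX in hD1.
have -> : K2 * ln (1 + y) = D%:R * (4%:R * 2%:R ^+ m * ln (1 + y)) by rewrite /K2; ring.
rewrite /K1 mulrDl; lra.
Qed.

End logistic_step.

(** * Jensen's inequality for polynomials in the squared Cayley map *)

Section majorants.
Variable R : realType.

Notation mu := (@lebesgue_measure R).
Notation T := (@Tpar R).

(* On the circle [cayley2 (expi t) = cot2 t], the square of [cot (t / 2)]; at [t = 0] both are [0]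
   since division by zero gives [0]. *)
Definition cayley2 (z : R[i]) : R[i] := - ((1 + z) / (1 - z)) ^+ 2.
Definition cot2 (t : R) : R := (1 + cos t) / (1 - cos t).

Lemma cot2_ge0 t : 0 <= cot2 t.
Proof.
apply: divr_ge0; last by rewrite subr_ge0 cos_le1.
by have := cos_geN1 t; rewrite -[1 + _]opprK oppr_ge0 opprD; lra.
Qed.

Lemma cayley2_expi (t : R) : cayley2 (expi t) = (cot2 t)%:C.
Proof.
have cs := cos2Dsin2 t.
have [c1|c1] := eqVneq (cos t) 1.
  have s0 : sin t = 0.
    by apply/eqP; rewrite -sqrf_eq0; apply/eqP; move: cs; rewrite c1; lra.
  have e1 : expi t = 1 :> R[i] by rewrite /expi c1 s0.
  by rewrite /cayley2 e1 /cot2 c1 !subrr !invr0 !mulr0 expr0n oppr0.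
have nz : 1 - cos t != 0 by rewrite subr_eq0 eq_sym.
have ez : 1 - expi t != 0 :> R[i].
  by rewrite subr_eq0 eq_complex /= negb_and eq_sym c1.
rewrite /cayley2 /cot2 expr_div_n.
have ez2 : (1 - expi t) ^+ 2 != 0 :> R[i] by rewrite expf_neq0.
apply: (mulIf ez2); rewrite mulNr divfK //.
have nzC : (1 - cos t)%:C != 0 :> R[i] by rewrite (inj_eq (@complexI _) _ 0).
apply: (mulfI nzC); rewrite mulrA -rmorphM /= (mulrC (1 - cos t)) divfK //.
rewrite !expr2 /expi; apply/eqP; rewrite eq_complex /=.
have cs2 : sin t * sin t = 1 - cos t * cos t by rewrite -!expr2 -cs; ring.
by apply/andP; split; apply/eqP; ring: cs2.
Qed.

(** With integrability bundled in, the relation is additive, so the logarithm of a product can be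
    treated factor by factor. *)
Definition poisson_majorant (z : Cx R) (h : R -> R) (x : R) :=
  mu.-integrable T (EFin \o h) /\ x <= poisson_int z h.

Lemma integrable_T0_eq (h k : R -> R) : mu.-integrable T (EFin \o h) ->
  (forall t, 0 < t < pi *+ 2 -> k t = h t) -> mu.-integrable T (EFin \o k).
Proof.
move=> hi kh.
have m0 : measurable_fun T (EFin \o k).
  apply/emeasurable_fun_itv_obnd_cbndP.
  apply: (eq_measurable_fun (EFin \o h)).
    by move=> t; rewrite inE /= in_itv /= => t0; rewrite kh.
  by apply/emeasurable_fun_itv_obnd_cbndP; exact: (measurable_int mu hi).
apply/integrableP; split => //.
have /integrableP[mh] := hi.
rewrite /Tpar -!integral_itv_obnd_cbnd; last 2 first.
- by apply: measurableT_comp => //; apply/emeasurable_fun_itv_obnd_cbndP.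
- by apply: measurableT_comp => //; apply/emeasurable_fun_itv_obnd_cbndP.
apply: le_lt_trans; rewrite le_eqVlt; apply/orP; left; apply/eqP; apply: eq_integral => t.
by rewrite inE /= in_itv /= => t0; rewrite kh.
Qed.

Lemma poisson_majorant_eq (z : Cx R) h k x : udisc z -> poisson_majorant z h x ->
  (forall t, 0 < t < pi *+ 2 -> k t = h t) -> poisson_majorant z k x.
Proof.
move=> zD [hi hx] kh; have ki := integrable_T0_eq hi kh.
split=> //; apply: le_trans hx _; apply: le_poisson_int => // t t0.
by rewrite kh.
Qed.

Lemma poisson_majorantD (z : Cx R) h k x y : udisc z -> poisson_majorant z h x ->
  poisson_majorant z k y -> poisson_majorant z (fun t => h t + k t) (x + y).
Proof. by move=> zD [hi hx] [ki ky]; split; [exact: integrableDR|rewrite poisson_intD // lerD]. Qed.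

Lemma poisson_majorant_cst (z : Cx R) c : udisc z -> poisson_majorant z (fun=> c) c.
Proof. by move=> zD; split; [exact: cst_integrable|rewrite poisson_int_cst]. Qed.

(** A negative coefficient reverses Jensen's inequality, so the denominator needs the exact value of
    its Poisson integral. *)
Lemma poisson_majorant_Nln1 (z : Cx R) : udisc z ->
  poisson_majorant z (fun t => -1 * ln (modc (1 - expi t))) (-1 * ln (modc (1 - z))).
Proof.
move=> zD; split; first by apply: integrableZ; exact: integrable_lnB1.
rewrite poisson_intZ //; last exact: integrable_lnB1.
by rewrite poisson_int_lnB1.
Qed.

Lemma poisson_int_affine (z : Cx R) (a b : R[i]) : udisc z -> modc b < modc a ->
  mu.-integrable T (EFin \o (fun t => ln (modc (a + b * expi t)))) /\
  poisson_int z (fun t => ln (modc (a + b * expi t))) = ln (modc (a + b * z)).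
Proof.
move=> zD ab.
have a0 : a != 0 by rewrite -modc_gt0 (le_lt_trans (modc_ge0 b)).
pose c := - (b / a).
have c1 : modc c < 1 by rewrite modcN modcM modcV ltr_pdivrMr ?mul1r // modc_gt0.
have E (e : R[i]) : modc e <= 1 -> ln (modc (a + b * e)) = ln (modc a) + ln (modc (1 - c * e)).
  move=> e1.
  have -> : a + b * e = a * (1 - c * e) by rewrite /c; field.
  rewrite modcM lnM ?posrE ?modc_gt0 // oneB_neq0 // modcM.
  by apply: le_lt_trans c1; rewrite ler_piMr // modc_ge0.
have ei : mu.-integrable T (EFin \o (fun t => ln (modc (1 - c * expi t)))).
  exact: continuous_integrable (continuous_ln_modc c1).
have -> : (fun t => ln (modc (a + b * expi t))) =
  (fun t => ln (modc a) + ln (modc (1 - c * expi t))).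
  by apply/funext => t; rewrite E // modc_expi.
split; first by apply: integrableDR => //; exact: cst_integrable.
rewrite poisson_intD //; last exact: cst_integrable.
by rewrite poisson_int_cst // poisson_int_lnBM // -E // ltW.
Qed.

Lemma conj_affine (a b e : R[i]) : (a + b * e)^*%C = a^*%C + b^*%C * e^*%C.
Proof. by rewrite rmorphD rmorphM. Qed.

(* A factor [a + b z] vanishing in the disc is replaced by its reflection [b^* + a^* z], which has no
   zero there, the same modulus on the circle and a larger one inside. *)
Lemma modc_affine_flip (a b : R[i]) t : modc (a + b * expi t) = modc (b^*%C + a^*%C * expi t).
Proof.
have e0 : expi t != 0 :> R[i] by rewrite -modc_gt0 modc_expi.
rewrite -modcJ (conj_affine a b (expi t)) conj_expi.
have -> : a^*%C + b^*%C / expi t = (b^*%C + a^*%C * expi t) / expi t by field.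
by rewrite modcM modcV modc_expi invr1 mulr1.
Qed.

Lemma modc_flip_le (a b z : R[i]) : modc a <= modc b -> modc z <= 1 ->
  modc (a + b * z) <= modc (b^*%C + a^*%C * z).
Proof.
move=> ab z1.
apply: (le_of_sqr (modc_ge0 _)); rewrite -subr_ge0.
have -> : modc (b^*%C + a^*%C * z) ^+ 2 - modc (a + b * z) ^+ 2 =
  (modc b ^+ 2 - modc a ^+ 2) * (1 - modc z ^+ 2).
  by rewrite !modc_sqr; case: a b z {ab z1} => [a1 a2] [b1 b2] [z1 z2] /=; ring.
apply: mulr_ge0; rewrite subr_ge0.
  by rewrite lerXn2r ?nnegrE ?modc_ge0.
by rewrite expr_le1 ?modc_ge0.
Qed.

(** The excluded case of equal moduli is a zero on the circle; in the factorisation below it occurs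
    only for the denominator [1 - z]. *)
Lemma poisson_majorant_affine (z : Cx R) (a b : R[i]) : udisc z -> modc a != modc b ->
  a + b * z != 0 ->
  poisson_majorant z (fun t => ln (modc (a + b * expi t))) (ln (modc (a + b * z))).
Proof.
move=> zD ab nz; case: (ltgtP (modc a) (modc b)) ab => // ab _; last first.
  by have [h1 h2] := poisson_int_affine zD ab; split=> //; rewrite h2.
have -> : (fun t => ln (modc (a + b * expi t))) = (fun t => ln (modc (b^*%C + a^*%C * expi t))).
  by apply/funext => t; rewrite modc_affine_flip.
have [|h1 h2] := @poisson_int_affine z b^*%C a^*%C zD; first by rewrite !modcJ.
split=> //; rewrite h2 ler_ln ?posrE ?modc_gt0 //.
  by apply: modc_flip_le; exact: ltW.
rewrite -modc_gt0; apply: lt_le_trans (_ : modc (a + b * z) <= _); first by rewrite modc_gt0.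
by apply: modc_flip_le; exact: ltW.
Qed.

(* With [e ^+ 2 = - zeta] this splits [cayley2 z - zeta] into factors affine in [z]. *)
Lemma cayley2_factor (e z : R[i]) : 1 - z != 0 ->
  cayley2 z + e ^+ 2 = ((e + 1) + (1 - e) * z) * ((e - 1) + (- (e + 1)) * z) / (1 - z) ^+ 2.
Proof. by move=> z1; rewrite /cayley2; field. Qed.

(** Since [zeta] is off the half-line, a square root [e] of [- zeta] has nonzero real part.
    Equivalently [e + 1] and [1 - e] have different moduli, so neither affine factor vanishes on the
    circle. *)
Lemma poisson_majorant_cayley2 (z : Cx R) (zeta : R[i]) : udisc z ->
  (forall y : R, 0 <= y -> zeta != y%:C) -> cayley2 z != zeta ->
  poisson_majorant z (fun t => ln (modc (cayley2 (expi t) - zeta))) (ln (modc (cayley2 z - zeta))).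
Proof.
move=> zD zR nz; pose e := sqrtc (- zeta).
have ee : e ^+ 2 = - zeta by rewrite /e sqr_sqrtc.
have Ree : complex.Re e != 0.
  apply/eqP => r0; have /eqP := zR (complex.Im e ^+ 2) (sqr_ge0 _); apply.
  rewrite -[zeta]opprK -ee; move: r0; case: (e) => x y /= ->.
  by apply/eqP; rewrite eq_complex expr2 /=; apply/andP; split; apply/eqP; ring.
have F (w : R[i]) : 1 - w != 0 -> cayley2 w != zeta ->
   [/\ e + 1 + (1 - e) * w != 0, e - 1 + - (e + 1) * w != 0 &
   ln (modc (cayley2 w - zeta)) = ln (modc (e + 1 + (1 - e) * w)) +
     ln (modc (e - 1 + - (e + 1) * w)) + (-1 * ln (modc (1 - w)) + -1 * ln (modc (1 - w)))].
  move=> w1; rewrite -subr_eq0 -ee (cayley2_factor _ w1).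
  set A := e + 1 + _; set B := e - 1 + _;
    rewrite mulf_eq0 mulf_eq0 !negb_or => /andP[/andP[A0 B0] _].
  have w2 : 0 < modc (1 - w) by rewrite modc_gt0.
  split=> //; rewrite !modcM modcV modcX.
  rewrite lnM ?posrE ?mulr_gt0 ?invr_gt0 ?exprn_gt0 ?modc_gt0 //.
  by rewrite lnM ?posrE ?modc_gt0 // lnV ?posrE ?exprn_gt0 // lnXn // !mulN1r mulr2n opprD.
have z1 : 1 - z != 0 :> R[i] := one_sub_neq0 zD.
have ne1 : modc (e + 1) != modc (1 - e).
  apply/eqP => /(congr1 (fun x => x ^+ 2)); rewrite !modc_sqr.
  by move/eqP: Ree; case: (e) => x y /= x0 h; apply: x0; lra.
have ne2 : modc (e - 1) != modc (- (e + 1)).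
  by rewrite modcN eq_sym -(modcN (e - 1)) opprB.
have [n1 n2 Fz] := F z z1 nz.
rewrite Fz; apply: (@poisson_majorant_eq z _ _ _ zD); last first.
  move=> t t0; have [||_ _ ->] := F (expi t); first exact: expi_neq1.
    by rewrite cayley2_expi eq_sym zR // cot2_ge0.
  by [].
apply: poisson_majorantD => //; last by apply: poisson_majorantD => //;
  exact: poisson_majorant_Nln1.
by apply: poisson_majorantD => //; exact: poisson_majorant_affine.
Qed.

Lemma poisson_majorant_poly (p : {poly R}) (z : Cx R) : (forall y, 1 <= p.[y]) -> udisc z ->
  evalC p (cayley2 z) != 0 ->
  poisson_majorant z (fun t => ln p.[cot2 t]) (ln (modc (evalC p (cayley2 z)))).
Proof.
move=> p1 zD nz; set P := map_poly (real_complex R) p.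
have [rs Prs] := closed_field_poly_normal P.
have root_rs zeta : zeta \in rs -> P.[zeta] = 0.
  by move=> zi; rewrite Prs hornerZ horner_prod (big_rem zeta) //= hornerXsubC subrr mul0r mulr0.
(* The bound [1 <= p] on the real line is what keeps the roots off the half-line. *)
have zetaR zeta : zeta \in rs -> forall y : R, 0 <= y -> zeta != y%:C.
  move=> zi y y0; apply/eqP => zy; have := root_rs _ zi.
  rewrite zy horner_map /= => /(congr1 (@complex.Re R)) /= h.
  by have := p1 y; rewrite h ler10.
have ev w : evalC p w = lead_coef P * \prod_(s <- rs) (w - s).
  rewrite /evalC -/P [in LHS]Prs hornerZ horner_prod; congr (_ * _).
  by apply: eq_bigr => s _; rewrite hornerXsubC.
have M s : {subset s <= rs} -> all (fun zeta => cayley2 z != zeta) s ->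
  poisson_majorant z (fun t => ln (modc (\prod_(x <- s) (cayley2 (expi t) - x))))
    (ln (modc (\prod_(x <- s) (cayley2 z - x)))).
  elim: s => [_ _|x s IH sub /= /andP[vx al]].
    have -> : (fun t => ln (modc (\prod_(x <- [::]) (cayley2 (expi t) - x)))) = fun=> ln 1.
      by apply/funext => t; rewrite big_nil modc1.
    by rewrite big_nil modc1; exact: poisson_majorant_cst.
  have xR := zetaR x (sub _ (mem_head _ _)).
  have subs : {subset s <= rs} by move=> y ys; apply: sub; rewrite in_cons ys orbT.
  have L w : cayley2 w != x -> all (fun zeta => cayley2 w != zeta) s ->
      ln (modc (\prod_(y <- x :: s) (cayley2 w - y))) =
        ln (modc (cayley2 w - x)) + ln (modc (\prod_(y <- s) (cayley2 w - y))).
    move=> wx wal; rewrite big_cons modcM lnM // posrE modc_gt0 ?subr_eq0 //.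
    rewrite prodf_seq_neq0; apply/allP => y ys /=; rewrite subr_eq0.
    by move/allP: wal => /(_ y ys).
  have -> : (fun t => ln (modc (\prod_(y <- x :: s) (cayley2 (expi t) - y)))) =
    (fun t => ln (modc (cayley2 (expi t) - x)) + ln (modc (\prod_(y <- s) (cayley2 (expi t) - y)))).
    apply/funext => t; apply: L.
      by rewrite cayley2_expi eq_sym xR // cot2_ge0.
    by apply/allP => y ys; rewrite cayley2_expi eq_sym zetaR ?cot2_ge0 // subs.
  rewrite L //; apply: poisson_majorantD => //; last exact: IH.
  exact: poisson_majorant_cayley2.
have lc0 : lead_coef P != 0 by apply: contra nz; rewrite ev => /eqP ->; rewrite mul0r.
have pr0 : \prod_(s <- rs) (cayley2 z - s) != 0 by apply: contra nz; rewrite ev => /eqP ->;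
  rewrite mulr0.
have -> : (fun t => ln p.[cot2 t]) = (fun t => ln (modc (lead_coef P)) +
  ln (modc (\prod_(x <- rs) (cayley2 (expi t) - x)))).
  apply/funext => t; have e := ev (cayley2 (expi t)).
  have e1 : modc (evalC p (cayley2 (expi t))) = p.[cot2 t].
    by rewrite cayley2_expi evalC_real modc_real ger0_norm // (le_trans ler01).
  rewrite -e1 e modcM lnM // posrE modc_gt0 //.
  rewrite prodf_seq_neq0; apply/allP => y ys /=; rewrite subr_eq0 cayley2_expi eq_sym.
  by rewrite zetaR // cot2_ge0.
rewrite ev modcM lnM ?posrE ?modc_gt0 //.
apply: poisson_majorantD => //; first exact: poisson_majorant_cst.
apply: M => //; apply/allP => y ys; move: pr0.
by rewrite prodf_seq_neq0 => /allP /(_ y ys); rewrite /= subr_eq0.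
Qed.

(** The mean is exactly [2 * ln (1 + a^-1)]: here [zeta] is [- a ^+ 2], its associated root [e] is
    [a], and both affine factors contribute [ln (a + 1)]. *)
Lemma poisson_int0_ln (a : R) : 0 < a ->
  mu.-integrable T (EFin \o (fun t => ln (1 + cot2 t / a ^+ 2))) /\
  poisson_int (0 : Cx R) (fun t => ln (1 + cot2 t / a ^+ 2)) <= 2 / a.
Proof.
move=> a0; have aN : a != 0 by rewrite gt_eqF.
have z0 : udisc (0 : Cx R) by rewrite /udisc /= modc0.
pose e : R[i] := a%:C.
have a1 : 0 < a + 1 by rewrite addr_gt0.
have M1 : modc (e + 1) = a + 1 by rewrite -(rmorph1 (real_complex R)) -rmorphD /= modc_real
  gtr0_norm.
have M2 : modc (1 - e) < a + 1.
  by rewrite -(rmorph1 (real_complex R)) -rmorphB /= modc_real ltr_norml; apply/andP; split; lra.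
have [i1 e1] : mu.-integrable T (EFin \o (fun t => ln (modc (e + 1 + (1 - e) * expi t)))) /\
  poisson_int (0 : Cx R) (fun t => ln (modc (e + 1 + (1 - e) * expi t))) = ln (a + 1).
  by have := @poisson_int_affine 0 (e + 1) (1 - e) z0; rewrite M1 => /(_ M2);
    rewrite mulr0 addr0 M1.
have [i2 e2] : mu.-integrable T (EFin \o (fun t => ln (modc (e - 1 + - (e + 1) * expi t)))) /\
  poisson_int (0 : Cx R) (fun t => ln (modc (e - 1 + - (e + 1) * expi t))) = ln (a + 1).
  (* This factor vanishes inside the disc, so its mean is read off its reflection. *)
  have -> : (fun t => ln (modc (e - 1 + - (e + 1) * expi t))) =
    (fun t => ln (modc ((- (e + 1))^*%C + (e - 1)^*%C * expi t))).
    by apply/funext => t; congr ln; exact: modc_affine_flip.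
  have := @poisson_int_affine 0 (- (e + 1))^*%C (e - 1)^*%C z0.
  rewrite !modcJ modcN M1 -(modcN (e - 1)) opprB => /(_ M2).
  by rewrite mulr0 addr0 modcJ modcN M1.
have i3 : mu.-integrable T (EFin \o (fun t => -1 * ln (modc (1 - expi t : R[i])))).
  by apply: integrableZ; exact: integrable_lnB1.
have e3 : poisson_int (0 : Cx R) (fun t => -1 * ln (modc (1 - expi t : R[i]))) = 0.
  by rewrite poisson_intZ // ?poisson_int_lnB1 // ?subr0 ?modc1 ?ln1 ?mulr0 //;
    exact: integrable_lnB1.
pose h t := ln (modc (e + 1 + (1 - e) * expi t)) + ln (modc (e - 1 + - (e + 1) * expi t)) +
   (-1 * ln (modc (1 - expi t : R[i])) + -1 * ln (modc (1 - expi t : R[i]))) + (- (2 * ln a)).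
have hi : mu.-integrable T (EFin \o h).
  apply: integrableDR; last exact: cst_integrable.
  apply: integrableDR; last exact: integrableDR.
  exact: integrableDR.
have he : poisson_int (0 : Cx R) h = 2 * ln (a + 1) - 2 * ln a.
  rewrite /h poisson_intD //; [|by apply: integrableDR; exact: integrableDR|exact: cst_integrable].
  rewrite poisson_int_cst // poisson_intD //; [|exact: integrableDR|exact: integrableDR].
  by rewrite poisson_intD // poisson_intD // e1 e2 e3 !addr0; ring.
have ha t : 0 < t < pi *+ 2 -> ln (1 + cot2 t / a ^+ 2) = h t.
  move=> t0; have w1 := expi_neq1 t0.
  have vE : (cot2 t + a ^+ 2)%:C = (e + 1 + (1 - e) * expi t) * (e - 1 + - (e + 1) * expi t) /
    (1 - expi t) ^+ 2.
    by rewrite -cayley2_factor // rmorphD /= rmorphXn /= cayley2_expi.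
  have va : 0 < cot2 t + a ^+ 2 by rewrite ltr_wpDl ?cot2_ge0 // exprn_gt0.
  have nz : (cot2 t + a ^+ 2)%:C != 0 :> R[i] by rewrite -modc_gt0 modc_real gtr0_norm.
  have L1 : ln (cot2 t + a ^+ 2) = h t + 2 * ln a.
    rewrite /h addrNK -[cot2 t + _]gtr0_norm // -modc_real; move: nz; rewrite vE.
    set A := e + 1 + _; set B := e - 1 + _;
      rewrite mulf_eq0 mulf_eq0 !negb_or => /andP[/andP[A0 B0] _].
    have w2 : 0 < modc (1 - expi t : R[i]) by rewrite modc_gt0.
    rewrite !modcM modcV modcX.
    rewrite lnM ?posrE ?mulr_gt0 ?invr_gt0 ?exprn_gt0 ?modc_gt0 //.
    by rewrite lnM ?posrE ?modc_gt0 // lnV ?posrE ?exprn_gt0 // lnXn // !mulN1r mulr2n opprD.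
  have -> : 1 + cot2 t / a ^+ 2 = (cot2 t + a ^+ 2) / a ^+ 2 by field.
  by rewrite lnM ?posrE ?invr_gt0 ?exprn_gt0 // lnV ?posrE ?exprn_gt0 // lnXn // L1 mulr_natl addrK.
have ki := integrable_T0_eq hi ha; split => //.
apply: le_trans (_ : poisson_int (0 : Cx R) h <= _).
  by apply: le_poisson_int => // t t0; rewrite ha.
rewrite he -mulrBr -ln_div ?posrE // ler_wpM2l //.
have -> : (a + 1) / a = 1 + a^-1 by field.
by apply: le_ln1Dx; apply: lt_trans (_ : 0 < _); rewrite ?ltrN10 // invr_gt0.
Qed.

End majorants.

(** * The limit function *)

Section limit_function.
Variable R : realType.

Implicit Types (p q : {poly R}).

Definition half_pow (k : nat) : R := (1 / 2) ^+ k.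

Lemma half_pow_gt0 k : 0 < half_pow k.
Proof. by rewrite exprn_gt0. Qed.

Lemma half_powS k : half_pow k = half_pow k.+1 + half_pow k.+1.
Proof. by rewrite /half_pow exprS; lra. Qed.

Lemma half_pow_le j k : (j <= k)%N -> half_pow k <= half_pow j.
Proof. by move=> jk; rewrite /half_pow ler_wiXn2l //; lra. Qed.

Lemma half_pow_cvg (C : R) : C * half_pow k @[k --> \oo] --> (0 : R).
Proof.
rewrite -(mulr0 C); apply: cvgM; first exact: cvg_cst.
by apply: cvg_expr; rewrite ger0_norm; lra.
Qed.

Lemma le_half_pow_lim (x y C : R) K : (forall k, (K <= k)%N -> x <= y + C * half_pow k) -> x <= y.
Proof.
move=> h; have c : y + C * half_pow k @[k --> \oo] --> (y + 0 : R).
  by apply: cvgD; [exact: cvg_cst|exact: half_pow_cvg].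
rewrite -[y]addr0; apply: (cvgr_to_ge c); exists K => // k /=; exact: h.
Qed.

Lemma fast_cauchyR (x : nat -> R) K : (forall k, (K <= k)%N -> `|x k.+1 - x k| <= half_pow k.+1) ->
  exists l, forall k, (K <= k)%N -> `|l - x k| <= half_pow k.
Proof.
move=> h.
have mono n k : (K <= k)%N -> `|x (k + n)%N - x k| <= half_pow k - half_pow (k + n).
  move=> Kk; elim: n => [|n IH]; first by rewrite addn0 !subrr normr0.
  have h1 := h (k + n)%N (leq_trans Kk (leq_addr _ _)).
  rewrite addnS; have -> : x (k + n).+1 - x k =
    (x (k + n).+1 - x (k + n)%N) + (x (k + n)%N - x k) by ring.
  apply: le_trans (ler_normD _ _) _; have := half_powS (k + n); lra.
have cmp j k : (K <= j)%N -> (K <= k)%N -> x j - half_pow j <= x k + half_pow k.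
  move=> Kj Kk; have [jk|kj] := leqP j k.
    have := mono (k - j)%N j Kj; rewrite subnKC // ler_norml => /andP[h1 _].
    have := half_pow_gt0 k; lra.
  have := mono (j - k)%N k Kk; rewrite subnKC ?(ltnW kj) // ler_norml => /andP[_ h1].
  have := half_pow_gt0 j; lra.
(* The intervals of radius [half_pow k] around [x k] meet pairwise, so the supremum of their left
   ends lies in all of them. *)
pose A : set R := [set x k - half_pow k | k in [set k | (K <= k)%N]].
have A0 : A !=set0 by exists (x K - half_pow K), K => /=.
have Aub k : (K <= k)%N -> ubound A (x k + half_pow k).
  by move=> Kk _ [j /= Kj <-]; exact: cmp.
exists (sup A) => k Kk; rewrite ler_norml; apply/andP; split.
  rewrite lerBrDr addrC.
  by apply: ub_le_sup; [exists (x K + half_pow K); exact: Aub|exists k].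
by rewrite lerBlDr addrC; apply: ge_sup => //; exact: Aub.
Qed.

Lemma Im_le_modc (w : R[i]) : `|complex.Im w| <= modc w.
Proof.
have -> : complex.Im w = - complex.Re (w * 'i%C) by rewrite ReiNIm opprK.
rewrite normrN; apply: le_trans (Re_le_modc _) _; rewrite modcM.
by rewrite [X in _ * X](_ : _ = 1) ?mulr1 // /modc normc_def /= expr0n expr1n add0r sqrtr1.
Qed.

Lemma fast_cauchyC (u : nat -> R[i]) K :
  (forall k, (K <= k)%N -> modc (u k.+1 - u k) <= half_pow k.+1) ->
  exists l, forall k, (K <= k)%N -> modc (l - u k) <= 2 * half_pow k.
Proof.
move=> h.
have [|lr hr] := @fast_cauchyR (fun k => complex.Re (u k)) K.
  by move=> k Kk; apply: le_trans (h k Kk); rewrite -raddfB Re_le_modc.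
have [|li hi] := @fast_cauchyR (fun k => complex.Im (u k)) K.
  by move=> k Kk; apply: le_trans (h k Kk); rewrite -raddfB Im_le_modc.
exists (lr +i* li) => k Kk; apply: le_trans (modc_le_norm _) _.
rewrite mulr_natl mulr2n; move: (hr k Kk) (hi k Kk); case: (u k) => a b /=; exact: lerD.
Qed.

(** The hypotheses sit inside the relation, so that every input has some output, as [choice]
    requires, and the recursion can run on arbitrary pairs. *)
Definition step_spec p (r e : R) (d : {poly R} * R * (R * R * (R * R))) :=
  let: (q, t, (K1, a1, (K2, a2))) := d in
  (forall y, 1 <= p.[y]) -> 0 <= r -> 0 < e ->
  [/\ [/\ forall y, 1 <= q.[y], pnorm r (q - p) <= e & e^-1 <= t],
      [/\ 0 <= K1, 0 <= K2, 0 < a1, 0 < a2 & K1 / a1 + K2 / a2 <= e],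
      t / e <= a2, forall v, 0 <= v <= a2 ^+ 2 -> q.[v] <= t &
      forall v, 0 <= v -> ln q.[v] <= ln p.[v] + e + K1 * ln (1 + v / a1 ^+ 2) +
        K2 * ln (1 + v / a2 ^+ 2)].

(** The tolerances [half_pow k.+2] sum from [k] on to [half_pow k.+1]. The next radius covers
    [[0, a2 k ^+ 2]], so that later steps barely disturb the bound [t k] obtained there. The initial
    radius 6 reaches, with margin 2, the point [-4] at which nonconstancy is tested. *)
Lemma iterated_steps : exists (E : nat -> {poly R}) (r t K1 a1 K2 a2 : nat -> R),
  [/\ E 0%N = 1 + 'X^2, r 0%N = 6, forall k, r k + a2 k ^+ 2 + 2 <= r k.+1 &
  forall k,
  [/\ [/\ forall y, 1 <= (E k).[y], pnorm (r k) (E k.+1 - E k) <=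
    half_pow k.+2 & (half_pow k.+2)^-1 <= t k],
      [/\ 0 <= K1 k, 0 <= K2 k, 0 < a1 k, 0 < a2 k & K1 k / a1 k + K2 k / a2 k <= half_pow k.+2],
      t k / half_pow k.+2 <= a2 k, forall v, 0 <= v <= a2 k ^+ 2 -> (E k.+1).[v] <= t k &
      forall v, 0 <= v -> ln (E k.+1).[v] <=
        ln (E k).[v] + half_pow k.+2 + K1 k * ln (1 + v / a1 k ^+ 2) +
          K2 k * ln (1 + v / a2 k ^+ 2)]].
Proof.
have ex (x : {poly R} * R * R) : exists d, step_spec x.1.1 x.1.2 x.2 d.
  case: x => -[p r] e /=.
  have [H|H] := pselect [/\ forall y, 1 <= p.[y], 0 <= r & 0 < e].
    have [p1 r0 e0] := H.
    have [q [t [K1 [a1 [K2 [a2 h]]]]]] := polynomial_step p1 r0 e0.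
    by exists (q, t, (K1, a1, (K2, a2))).
  by exists (0, 0, (0, 0, (0, 0))) => p1 r0 e0; exfalso; apply: H.
have [F HF] := choice ex.
pose nxt (k : nat) (s : {poly R} * R) := F (s, half_pow k.+2).
pose st := fix st (k : nat) : {poly R} * R := if k is k'.+1 then
  ((nxt k' (st k')).1.1, (st k').2 + (nxt k' (st k')).2.2.2 ^+ 2 + 2) else (1 + 'X^2, 6).
have st_ok k : (forall y, 1 <= (st k).1.[y]) /\ 0 <= (st k).2.
  elim: k => [|k [IH1 IH2]].
    by split => // y; rewrite /= hornerD hornerXn hornerC lerDl sqr_ge0.
  have := HF (st k, half_pow k.+2); rewrite -/(nxt k (st k)) /=.
    case E : (nxt k (st k)) => [[q t] [[K1 a1] [K2 a2]]] /= h.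
  have [[q1 _ _] _ _ _ _] := h IH1 IH2 (half_pow_gt0 _).
  split => //; by rewrite !addr_ge0 // sqr_ge0.
exists (fun k => (st k).1), (fun k => (st k).2), (fun k => (nxt k (st k)).1.2),
  (fun k => (nxt k (st k)).2.1.1), (fun k => (nxt k (st k)).2.1.2),
  (fun k => (nxt k (st k)).2.2.1), (fun k => (nxt k (st k)).2.2.2).
split => // k.
have [h1 h2] := st_ok k.
have := HF (st k, half_pow k.+2); rewrite -/(nxt k (st k)) /=.
case: (nxt k (st k)) => [[q t] [[K1 a1] [K2 a2]]] /= h.
have [[q1 A2 A3] B C D G] := h h1 h2 (half_pow_gt0 _).
by split.
Qed.

(** * The entire limit and its derivative *)

Section limit.
Variables (E : nat -> {poly R}) (r : nat -> R).
Hypothesis r0 : r 0%N = 6.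
Hypothesis rS : forall k, r k + 2 <= r k.+1.
Hypothesis Ecl : forall k, pnorm (r k) (E k.+1 - E k) <= half_pow k.+2.

Lemma r_ge k n : r k + n%:R <= r (k + n)%N.
Proof.
elim: n => [|n IH]; first by rewrite addr0 addn0.
by rewrite addnS; apply: le_trans (rS _); rewrite -natr1; lra.
Qed.

Lemma r_mono j k : (j <= k)%N -> r j <= r k.
Proof.
move=> jk; rewrite -(subnKC jk); apply: le_trans (r_ge _ _); by rewrite lerDl.
Qed.

Lemma r_gt0 k : 0 <= r k.
Proof. by have := r_mono (leq0n k); rewrite r0; lra. Qed.

Lemma r_unbounded (x : R) : exists K, forall k, (K <= k)%N -> x <= r k.
Proof.
exists (Num.bound `|x|) => k Kk.
have h := archi_boundP (normr_ge0 x).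
apply: le_trans (r_mono Kk); have := r_ge 0 (Num.bound `|x|).
rewrite add0n r0; have := ler_norm x; lra.
Qed.

Lemma E_tail k n : pnorm (r k) (E (k + n) - E k) <= half_pow k.+1 - half_pow (k + n).+1.
Proof.
elim: n => [|n IH]; first by rewrite addn0 !subrr -[0]/(0%:P) pnormC normr0.
rewrite addnS; have -> : E (k + n).+1 - E k =
  (E (k + n).+1 - E (k + n)%N) + (E (k + n)%N - E k) by ring.
apply: le_trans (pnormD _ _ (r_gt0 k)) _.
have h : pnorm (r k) (E (k + n).+1 - E (k + n)%N) <= half_pow (k + n).+2.
  by apply: le_trans (Ecl _); apply: pnorm_mono; rewrite r_gt0 r_mono // leq_addr.
have := half_powS (k + n).+1; lra.
Qed.

(** The limit of the derivatives is kept as well: differentiability then comes from passing to the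
    limit in [evalC_taylor]. The margin 2 is the one in [pnorm_deriv]. *)
Lemma limit_exists : exists g dg : R[i] -> R[i],
  (forall w k, modc w + 2 <= r k -> modc (g w - evalC (E k) w) <= 2 * half_pow k) /\
  (forall w k, modc w + 2 <= r k -> modc (dg w - evalC (E k)^`() w) <= 2 * half_pow k).
Proof.
have w0 w := @modc_ge0 R w.
have A (u : nat -> R[i]) w : (forall k, modc w + 2 <= r k -> modc (u k.+1 - u k) <= half_pow k.+1)
  ->
    exists l, forall k, modc w + 2 <= r k -> modc (l - u k) <= 2 * half_pow k.
  move=> key; have exK : exists k, modc w + 2 <= r k.
    by have [K hK] := r_unbounded (modc w + 2); exists K; exact: hK.
  (* Starting from the least admissible index makes the bound valid at every index with
     [modc w + 2 <= r k]. *)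
  case: (ex_minnP exK) => m wm mmin.
  have [|l hl] := @fast_cauchyC u m.
    by move=> k mk; apply: key; apply: le_trans wm (r_mono mk).
  by exists l => k wr; apply: hl; exact: mmin.
have B w k : modc w + 2 <= r k -> pnorm (modc w + 2) (E k.+1 - E k) <= half_pow k.+1.
  move=> wr; apply: le_trans (half_pow_le (leqnSn k.+1)); apply: le_trans (Ecl k).
  by apply: pnorm_mono; rewrite addr_ge0 //=.
have Hg w : exists l, forall k, modc w + 2 <= r k -> modc (l - evalC (E k) w) <= 2 * half_pow k.
  apply: (A (fun k => evalC (E k) w) w) => k wr.
  rewrite -evalCB; apply: le_trans (pnorm_evalC _ _) _; apply: le_trans (B w k wr).
  by apply: pnorm_mono; rewrite w0 /= lerDl.
have Hdg w : exists l, forall k, modc w + 2 <= r k ->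
  modc (l - evalC (E k)^`() w) <= 2 * half_pow k.
  apply: (A (fun k => evalC (E k)^`() w) w) => k wr.
  by rewrite -evalCB -derivB; apply: le_trans (pnorm_deriv _ _) _; exact: B.
have [g hg] := choice Hg; have [dg hdg] := choice Hdg.
by exists g, dg.
Qed.

Lemma limit_taylor (g dg : R[i] -> R[i]) :
  (forall w k, modc w + 2 <= r k -> modc (g w - evalC (E k) w) <= 2 * half_pow k) ->
  (forall w k, modc w + 2 <= r k -> modc (dg w - evalC (E k)^`() w) <= 2 * half_pow k) ->
  forall w, exists2 B, 0 < B & forall h, modc h <= 1 ->
    modc (g (w + h) - g w - h * dg w) <= modc h ^+ 2 * B.
Proof.
move=> hg hdg w; have w0 := @modc_ge0 R w.
(* One more than the usual margin, so that [w + h] with [modc h <= 1] is covered too. *)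
have [K hK] := r_unbounded (modc w + 3).
pose B := pnorm (modc w + 2) (E K) + 1.
have w2 : 0 <= modc w + 2 by rewrite addr_ge0.
have B0 : 0 < B by have := pnorm_ge0 (E K) w2; rewrite /B; lra.
exists B => // h h1; have h0 := @modc_ge0 R h.
(* Three approximation errors of [2 * half_pow k] each: at [w + h], at [w], and for the
   derivative. *)
apply: (@le_half_pow_lim _ _ 6 K) => k Kk.
have rk := hK k Kk.
have bB : pnorm (modc w + 2) (E k) <= B.
  have -> : E k = E K + (E k - E K) by rewrite addrC subrK.
  apply: le_trans (pnormD _ _ w2) _; rewrite lerD2l.
  have := E_tail K (k - K); rewrite subnKC // => h2.
  apply: le_trans (_ : pnorm (r K) (E k - E K) <= _).
    by apply: pnorm_mono; have := hK K (leqnn K); rewrite w2 /=; lra.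
  have := half_pow_gt0 k.+1; have := @half_pow_le 0 K.+1 isT; rewrite /half_pow expr0;
    rewrite -/(half_pow K.+1) -/(half_pow k.+1); lra.
have e1 : modc (g (w + h) - evalC (E k) (w + h)) <= 2 * half_pow k.
  by apply: hg; have := modcD w h; lra.
have e2 : modc (g w - evalC (E k) w) <= 2 * half_pow k by apply: hg; lra.
have e3 : modc (dg w - evalC (E k)^`() w) <= 2 * half_pow k by apply: hdg; lra.
have T := evalC_taylor (E k) w h1.
have -> : g (w + h) - g w - h * dg w =
  (evalC (E k) (w + h) - evalC (E k) w - h * evalC (E k)^`() w) +
    (g (w + h) - evalC (E k) (w + h)) -
   (g w - evalC (E k) w) - h * (dg w - evalC (E k)^`() w) by ring.
have T2 : modc h ^+ 2 * pnorm (modc w + 2) (E k) <= modc h ^+ 2 * B by rewrite ler_wpM2l // sqr_ge0.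
apply: le_trans (modcD _ _) _; rewrite modcN modcM.
have h3 : modc h * modc (dg w - evalC (E k)^`() w) <= 2 * half_pow k.
  by apply: le_trans e3; rewrite ler_piMl // modc_ge0.
have := modcD ((evalC (E k) (w + h) - evalC (E k) w - h * evalC (E k)^`() w) +
  (g (w + h) - evalC (E k) (w + h))) (- (g w - evalC (E k) w)).
have := modcD (evalC (E k) (w + h) - evalC (E k) w - h * evalC (E k)^`() w)
  (g (w + h) - evalC (E k) (w + h)).
rewrite modcN; lra.
Qed.

End limit.

(** * Differentiability of the composition with the Cayley map *)

Lemma cvgC_near (T : Type) (F : set_system T) {FF : Filter F} (f : T -> Cx R) (l : Cx R) :
  f @ F --> l -> forall e : R, 0 < e -> \forall x \near F, modc (f x - l) < e.
Proof. by move=> fl e e0; have := near_modc l e0; exact: fl. Qed.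

Lemma cayley_sqr_diff (F : fieldType) (z h : F) : 1 - z != 0 -> 1 - (z + h) != 0 ->
  - ((1 + (z + h)) / (1 - (z + h))) ^+ 2 - - ((1 + z) / (1 - z)) ^+ 2 =
  h * (- (2 * ((1 + (z + h)) * (1 - (z + h))^-1 + (1 + z) / (1 - z))) *
    ((1 - z) * (1 - (z + h)))^-1).
Proof. by move=> z1 nz; field; rewrite nz z1. Qed.

Lemma quotient_split (F : fieldType) (i g1 g0 q q0 d h : F) : h != 0 ->
  h^-1 * (i * g1 - i * g0) - i * (q0 * d) = i * ((q - q0) * d + h^-1 * (g1 - g0 - (h * q) * d)).
Proof. by move=> h0; field. Qed.

Lemma difference_quotientE (f : Cx R -> Cx R) (z h : Cx R) :
  h^-1 *: ((f \o shift z) (h *: 1) - f z) = (h : R[i])^-1 * (f (z + h) - f z) :> R[i].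
Proof.
have -> : h *: 1 = h :> Cx R by rewrite /GRing.scale /= mulr1.
by rewrite /= [h + z]addrC.
Qed.

Lemma modc_i : modc ('i%C : R[i]) = 1.
Proof. by rewrite /modc normc_def /= expr0n expr1n add0r sqrtr1. Qed.

Lemma derivable_comp_cayley (g : Cx R -> Cx R) (z d : Cx R) (B : R) : 1 - z != 0 -> 0 < B ->
  (forall h : R[i], modc h <= 1 -> modc (g (cayley2 z + h) - g (cayley2 z) - h * d) <=
    modc h ^+ 2 * B) ->
  derivable (fun x : Cx R => 'i%C * g (cayley2 x) : Cx R) z 1.
Proof.
move=> z1 B0 hB.
(* The difference quotient of [cayley2], in a form that is continuous at [h = 0]. *)
pose q (h : Cx R) : Cx R := - (2 * ((1 + (z + h)) * (1 - (z + h))^-1 + (1 + z) / (1 - z))) *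
  ((1 - z) * (1 - (z + h)))^-1.
have qc : q h @[h --> (0 : Cx R)] --> q 0.
  have c1 : (z + h : Cx R) @[h --> (0 : Cx R)] --> (z + 0 : Cx R) by apply: cvgCD;
    [exact: cvgC_cst|exact: cvgC_id].
  have c2 : (1 - (z + h) : Cx R) @[h --> (0 : Cx R)] --> (1 - (z + 0) : Cx R) by apply: cvgCB;
    [exact: cvgC_cst|exact: c1].
  have nz : 1 - (z + 0) != 0 :> R[i] by rewrite addr0.
  rewrite /q; apply: cvgCM; last first.
    apply: cvgCV; first by rewrite mulf_neq0.
    by apply: cvgCM; [exact: cvgC_cst|exact: c2].
  under eq_fun do rewrite -mulNr.
  rewrite -mulNr; apply: cvgCM; first exact: cvgC_cst.
  apply: cvgCD; last exact: cvgC_cst.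
  apply: cvgCM; first by apply: cvgCD; [exact: cvgC_cst|exact: c1].
  by apply: cvgCV; [exact: nz|exact: c2].
have vq h : 1 - (z + h) != 0 -> cayley2 (z + h) - cayley2 z = h * q h.
  by move=> nz; rewrite /cayley2 /q cayley_sqr_diff.
pose Q := modc (q 0) + 1.
have Q0 : 0 < Q by rewrite ltr_wpDl ?modc_ge0.
pose D := modc d + 1.
have D0 : 0 < D by rewrite ltr_wpDl ?modc_ge0.
apply: (@cvgP _ _ ('i%C * (q 0 * d) : Cx R)).
apply: cvgC_modc => e e0.
(* Closeness of [q h] to [q 0] controls the linear term. Of the bounds on [modc h], the first keeps
   [z + h] off the pole, the second keeps the increment of [cayley2] at most [1], and the third
   controls the quadratic remainder. *)
have m1 : 0 < Num.min 1 (e / 2 / D) by rewrite lt_min ltr01 !divr_gt0.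
have z1' : 0 < modc (1 - z) by rewrite modc_gt0.
have m2 : 0 < Num.min (modc (1 - z)) (Num.min Q^-1 (e / 2 / (Q ^+ 2 * B))).
  by rewrite !lt_min z1' invr_gt0 Q0 !divr_gt0 // mulr_gt0 // exprn_gt0.
have n1 := @cvgC_near _ _ (nbhs_filter (0 : Cx R)) _ _ qc _ m1; have n2 := near_modc (0 : Cx R) m2.
rewrite near_withinE; apply: (@filterS _ _ (nbhs_filter (0 : Cx R)) _ _ _ (filterI n1 n2)) => h.
move=> [] /=; rewrite subr0 !lt_min => /andP[q1 q2] /andP[h1 /andP[h2 h3]] hn.
have hz : 1 - (z + h) != 0.
  by apply: contraTneq h1 => /eqP; rewrite opprD addrA subr_eq0 => /eqP ->; rewrite ltxx.
have hn0 : 0 < modc h by rewrite modc_gt0.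
have qQ : modc (q h) <= Q.
  have := modcD (q h - q 0) (q 0); rewrite subrK => /le_trans; apply.
  by rewrite /Q addrC lerD2l ltW.
have hq1 : modc (h * q h) <= 1.
  rewrite modcM; apply: le_trans (_ : Q^-1 * Q <= _); last by rewrite mulVf // gt_eqF.
  by apply: ler_pM => //; rewrite ?modc_ge0 // ltW.
have := hB _ hq1; rewrite -(vq h hz) addrCA subrr addr0 => hE.
rewrite (_ : _ *: _ = (h : R[i])^-1 * ('i%C * g (cayley2 (z + h)) - 'i%C * g (cayley2 z)));
  last first.
  exact: (difference_quotientE (fun x : Cx R => 'i%C * g (cayley2 x) : Cx R) z h).
rewrite (quotient_split _ _ _ (q h) _ _ hn) -(vq h hz).
rewrite modcM modc_i mul1r [ltRHS](splitr e); apply: le_lt_trans (modcD _ _) _.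
rewrite !modcM modcV; apply: ler_ltD.
  apply: le_trans (_ : e / 2 / D * D <= _); last by rewrite divfK // gt_eqF.
  by apply: ler_pM; rewrite ?modc_ge0 // ?(ltW q2) // /D lerDl.
rewrite ltr_pdivrMl //; apply: le_lt_trans hE _; rewrite (vq h hz) modcM.
have hh : modc h * (Q ^+ 2 * B) < e / 2.
  by rewrite -ltr_pdivlMr // mulr_gt0 // exprn_gt0.
apply: le_lt_trans (_ : modc h * (modc h * (Q ^+ 2 * B)) < _); last by rewrite ltr_pM2l.
rewrite exprMn expr2 -!mulrA ler_wpM2l ?modc_ge0 // ler_wpM2l ?modc_ge0 //.
have qp := modc_ge0 (q h); have Bp := ltW B0.
by apply: ler_pM => //; rewrite ?mulr_ge0 // ler_wpM2r.
Qed.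

End limit_function.

(** * Passage to the limit *)

Section smirnov.
Variable R : realType.

Notation mu := (@lebesgue_measure R).
Notation T := (@Tpar R).
Notation half_pow := (half_pow R).

Lemma poisson0 t : poisson (0 : Cx R) t = 1.
Proof. by rewrite poissonE modc0 expr0n subr0 subr0 modc_expi expr1n divr1. Qed.

Lemma udisc0 : udisc (0 : Cx R).
Proof. by rewrite /udisc /= modc0. Qed.

Lemma EFin_integral0 (g : R -> R) : mu.-integrable T (EFin \o g) ->
  (\int[mu]_(t in T) (g t)%:E)%E = (pi *+ 2 * poisson_int (0 : Cx R) g)%:E.
Proof.
move=> gi; rewrite -(EFin_poisson_int udisc0 gi).
by apply: eq_integral => t _; rewrite poisson0 mulr1.
Qed.

Lemma cvg_ln_seq (u : nat -> R) (l : R) : 0 < l -> u @ \oo --> l -> ln (u k) @[k --> \oo] --> ln l.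
Proof. by move=> l0 ul; apply: (cvg_comp _ _ ul); exact: continuous_ln. Qed.

Section construction.
Variables (E : nat -> {poly R}) (K1 a1 K2 a2 : nat -> R) (G : R -> R).
Hypothesis E1 : forall k y, 1 <= (E k).[y].
Hypothesis K10 : forall k, 0 <= K1 k.
Hypothesis K20 : forall k, 0 <= K2 k.
Hypothesis a10 : forall k, 0 < a1 k.
Hypothesis a20 : forall k, 0 < a2 k.
Hypothesis Ka : forall k, K1 k / a1 k + K2 k / a2 k <= half_pow k.+2.
Hypothesis Eln : forall k v, 0 <= v -> ln (E k.+1).[v] <= ln (E k).[v] + half_pow k.+2 +
  K1 k * ln (1 + v / a1 k ^+ 2) + K2 k * ln (1 + v / a2 k ^+ 2).
Hypothesis G1 : forall x, 1 <= G x.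
Hypothesis EG : forall x, (E k).[x] @[k --> \oo] --> G x.

Let L k t := ln (E k).[cot2 t].
Let D k t : R := half_pow k.+2 + K1 k * ln (1 + cot2 t / a1 k ^+ 2) +
  K2 k * ln (1 + cot2 t / a2 k ^+ 2).

Lemma integrable_lnE k : mu.-integrable T (EFin \o L k).
Proof.
have nz : evalC (E k) (cayley2 (0 : Cx R)) != 0.
  have -> : cayley2 (0 : Cx R) = (-1)%:C :> R[i].
    by rewrite /cayley2 addr0 subr0 divr1 expr1n rmorphN rmorph1.
  rewrite evalC_real -modc_gt0 modc_real normr_gt0 gt_eqF //.
  exact: lt_le_trans ltr01 (E1 _ _).
by have [] := poisson_majorant_poly (E1 k) udisc0 nz.
Qed.

Lemma increment_ge0 k t : 0 <= D k t.
Proof.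
have h (a : R) : 0 < a -> 0 <= ln (1 + cot2 t / a ^+ 2).
  by move=> a0; rewrite ln_ge0 // lerDl divr_ge0 ?cot2_ge0 // exprn_ge0 // ltW.
have hp : 0 <= half_pow k.+2 by apply: ltW; exact: half_pow_gt0.
by apply: addr_ge0; [apply: addr_ge0 => //|]; apply: mulr_ge0 => //; apply: h.
Qed.

Lemma integrable_increment k : mu.-integrable T (EFin \o D k) /\ poisson_int (0 : Cx R) (D k) <=
  3 * half_pow k.+2.
Proof.
have [i1 p1] := poisson_int0_ln (a10 k); have [i2 p2] := poisson_int0_ln (a20 k).
have j1 := integrableZ (K1 k) i1; have j2 := integrableZ (K2 k) i2.
have j3 := cst_integrable (half_pow k.+2).
have j4 := integrableDR j3 j1.
split; first exact: integrableDR j4 j2.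
rewrite /D (poisson_intD udisc0 j4 j2) (poisson_intD udisc0 j3 j1) poisson_int_cst
  ?(poisson_intZ _ udisc0) //; try exact: udisc0.
have q1 := ler_wpM2l (K10 k) p1; have q2 := ler_wpM2l (K20 k) p2.
have e1 : K1 k * (2 / a1 k) = 2 * (K1 k / a1 k) by rewrite mulrCA.
have e2 : K2 k * (2 / a2 k) = 2 * (K2 k / a2 k) by rewrite mulrCA.
rewrite e1 in q1; rewrite e2 in q2; have := Ka k; lra.
Qed.

(** Extended-real, since only the integral of the series is controlled, not its convergence at each
    point. *)
Let H t : \bar R := ((L 0%N t)%:E + \sum_(0 <= k <oo) (D k t)%:E)%E.

Lemma lnE_ge0 k t : 0 <= L k t.
Proof. by rewrite /L ln_ge0. Qed.

Lemma lnE_le_majorant k t : ((L k t)%:E <= H t)%E.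
Proof.
have h : L k t <= L 0%N t + \sum_(0 <= j < k) D j t.
  elim: k => [|k IH]; first by rewrite big_geq // addr0.
  rewrite big_nat_recr //= addrA; apply: le_trans (Eln _ (cot2_ge0 t)) _.
  by have := IH; rewrite /L /D; lra.
apply: le_trans (_ : (L 0%N t + \sum_(0 <= j < k) D j t)%:E <= _)%E; first by rewrite lee_fin.
rewrite EFinD leeD2l // -sumEFin; apply: nneseries_lim_ge => j _ _.
by rewrite lee_fin increment_ge0.
Qed.

Lemma integrable_majorant : mu.-integrable T H.
Proof.
apply: integrableD => //; first exact: measurable_Tpar.
  exact: integrable_lnE.
have mD k : measurable_fun T (EFin \o D k) by have [/(measurable_int mu)] := integrable_increment k.
have mS : measurable_fun T (fun t => \sum_(0 <= k <oo) (D k t)%:E)%E.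
  have h0 k t : T t -> xpredT k -> (0 <= (EFin \o D k) t)%E by rewrite lee_fin increment_ge0.
  exact: (ge0_emeasurable_sum h0 (fun k _ => mD k)).
apply/integrableP; split => //.
have -> : (\int[mu]_(t in T) `|\sum_(0 <= k <oo) (D k t)%:E|)%E =
  (\int[mu]_(t in T) (\sum_(0 <= k <oo) (D k t)%:E))%E.
  apply: eq_integral => t _; rewrite gee0_abs //; apply: nneseries_ge0 => k _ _.
  by rewrite lee_fin increment_ge0.
have -> : (\int[mu]_(t in T) (\sum_(0 <= k <oo) (D k t)%:E))%E =
  (\sum_(0 <= k <oo) \int[mu]_(t in T) (D k t)%:E)%E.
  apply: (integral_nneseries mu (@measurable_Tpar R) mD) => k t _.
  by rewrite lee_fin increment_ge0.
have c0 : (0 <= pi *+ 2 * 3 :> R) by rewrite mulr_ge0 // ltW // pi2_gt0.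
apply: le_lt_trans (_ : (\sum_(0 <= k <oo) ((pi *+ 2 * 3) / (2 ^ (k + 2))%:R)%:E < +oo)%E).
  apply: lee_nneseries => k *.
    by apply: integral_ge0 => t _; rewrite lee_fin increment_ge0.
  have [i p] := integrable_increment k; rewrite (EFin_integral0 i) lee_fin -mulrA ler_wpM2l
    ?(ltW (pi2_gt0 _)) //.
  by apply: le_trans p _; rewrite /half_pow natrX addn2 expr_div_n expr1n mul1r.
have := @cvg_geometric_eseries_half R (pi *+ 2 * 3) 1 => /cvg_lim h.
by rewrite h // ltry.
Qed.

Lemma cvg_lnE t : L k t @[k --> \oo] --> ln (G (cot2 t)).
Proof.
apply: (@cvg_ln_seq (fun k => (E k).[cot2 t])); last exact: EG.
exact: lt_le_trans ltr01 (G1 _).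
Qed.

Lemma cvg_integral_lnE (z : Cx R) : udisc z ->
  mu.-integrable T (EFin \o (fun t => ln (G (cot2 t)) * poisson z t)) /\
  (\int[mu]_(t in T) (L k t * poisson z t)%:E)%E @[k --> \oo] -->
    (\int[mu]_(t in T) (ln (G (cot2 t)) * poisson z t)%:E)%E.
Proof.
move=> zD; have [B B0 hB] := poisson_bounded zD.
have LP k := integrable_poisson zD (integrable_lnE k).
have cv t : (L k t * poisson z t)%:E @[k --> \oo] --> (ln (G (cot2 t)) * poisson z t)%:E.
  apply: cvg_EFin; first exact: nearW.
  by apply: cvgM; [exact: cvg_lnE|exact: cvg_cst].
have HB : mu.-integrable T (fun t => B%:E * H t)%E.
  by apply: integrableZl; [exact: measurable_Tpar|exact: integrable_majorant].
have [//|||||i _ c] := @dominated_convergence _ _ _ mu T (@measurable_Tpar R)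
  (fun k t => (L k t * poisson z t)%:E) (fun t => (ln (G (cot2 t)) * poisson z t)%:E)
    (fun t => B%:E * H t)%E.
- by move=> k; exact: (measurable_int mu (LP k)).
- apply: (@emeasurable_fun_cvg _ _ _ _ (fun k t => (L k t * poisson z t)%:E)) => //.
  by move=> k; exact: (measurable_int mu (LP k)).
- by apply: aeW => t _; exact: cv.
- exact: HB.
- apply: aeW => t k _.
  rewrite gee0_abs ?lee_fin ?mulr_ge0 ?lnE_ge0 ?poisson_ge0 //.
  rewrite EFinM muleC lee_pmul ?lee_fin ?poisson_ge0 ?lnE_ge0 //.
  exact: lnE_le_majorant.
by split.
Qed.

Lemma integrable_lnG : mu.-integrable T (EFin \o (fun t => ln (G (cot2 t)))).
Proof.
have [+ _] := cvg_integral_lnE udisc0.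
have -> : (fun t => ln (G (cot2 t)) * poisson (0 : Cx R) t) = (fun t => ln (G (cot2 t))) => //.
by apply/funext => t; rewrite poisson0 mulr1.
Qed.

Lemma cvg_poisson_int_lnE (z : Cx R) : udisc z ->
  poisson_int z (L k) @[k --> \oo] --> poisson_int z (fun t => ln (G (cot2 t))).
Proof.
move=> zD; have [_] := cvg_integral_lnE zD.
rewrite (EFin_poisson_int zD integrable_lnG) => /fine_cvg c.
have -> : poisson_int z (fun t => ln (G (cot2 t))) =
  (pi *+ 2)^-1 * (pi *+ 2 * poisson_int z (fun t => ln (G (cot2 t)))).
  by rewrite mulKf // gt_eqF // pi2_gt0.
have -> : (fun k => poisson_int z (L k)) =
  (fun k => (pi *+ 2)^-1 * fine (\int[mu]_(t in T) (L k t * poisson z t)%:E)%E).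
  apply/funext => k; rewrite (EFin_poisson_int zD (integrable_lnE k)) /= mulKf //.
  by rewrite gt_eqF // pi2_gt0.
by apply: cvgM; [exact: cvg_cst|exact: c].
Qed.

Lemma ln_modc_limit_le (z : Cx R) (l : R[i]) : udisc z -> l != 0 ->
  modc (evalC (E k) (cayley2 z) - l) @[k --> \oo] --> (0 : R) ->
  ln (modc l) <= poisson_int z (fun t => ln (G (cot2 t))).
Proof.
move=> zD l0 cl; have l0' : 0 < modc l by rewrite modc_gt0.
have cm : modc (evalC (E k) (cayley2 z)) @[k --> \oo] --> modc l.
  apply/cvgrPdist_lt => e e0.
  have := @cvgr_dist_lt _ R^o _ _ eventually_filter _ _ cl _ e0; apply: filterS => k.
  rewrite sub0r normrN ger0_norm ?modc_ge0 //; apply: le_lt_trans.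
  rewrite distrC ler_norml modcB_ge andbT lerNl opprB -(modcN (_ - l)) opprB modcB_ge //.
have c1 := @cvg_ln_seq (fun k => modc (evalC (E k) (cayley2 z))) _ l0' cm.
have c2 := cvg_poisson_int_lnE zD.
apply: (ler_cvg_to c1 c2).
apply: (@filterS _ _ eventually_filter _ _ _ (cvgr_gt _ cm 0 l0')) => k /= hk.
have nz : evalC (E k) (cayley2 z) != 0 by rewrite -modc_gt0.
by have [] := poisson_majorant_poly (E1 k) zD nz.
Qed.

(** Markov's inequality for [ln (1 + cot2 t / a2 k ^+ 2)]: its mean is at most [2 / a2 k], and it is
    at least [ln 2 >= 1 / 2] wherever [G] reaches the level [s]. No arc length has to be
    computed. *)
Lemma distribution_bound k (s : R) : 0 < s -> (forall v : R, 0 <= v <= a2 k ^+ 2 -> G v < s) ->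
  (mT [set th | (s <= G (cot2 th))%R] <= (4 / a2 k)%:E)%E.
Proof.
move=> s0 hG; have [i2 p2] := poisson_int0_ln (a20 k).
pose h t := ln (1 + cot2 t / a2 k ^+ 2).
have mh : measurable_fun T (EFin \o h) := measurable_int mu i2.
have a22 : 0 < a2 k ^+ 2 by rewrite exprn_gt0.
have h0 x : 0 <= h x by rewrite ln_ge0 // lerDl divr_ge0 ?cot2_ge0 // ltW.
have half0 : 0 < 1 / 2 :> R by [].
have := le_integral_abse mu (@measurable_Tpar R) mh half0.
set B := T `&` _ => hB.
have mB : measurable B.
  apply: (emeasurable_fun_c_infty (@measurable_Tpar R)).
  have -> // : (fun x => `|(EFin \o h) x|%E) = EFin \o h.
  by apply/funext => x; rewrite gee0_abs // lee_fin.
have mA : measurable (T `&` [set th | (s <= G (cot2 th))%R]).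
  have -> : T `&` [set th | (s <= G (cot2 th))%R] =
    T `&` [set th | ((ln s)%:E <= (EFin \o (fun t => ln (G (cot2 t)))) th)%E].
    congr (T `&` _); apply/seteqP; split => th /=; rewrite lee_fin ler_ln ?posrE //;
      exact: lt_le_trans ltr01 (G1 _).
  apply: emeasurable_fun_c_infty; first exact: measurable_Tpar.
  exact: (measurable_int mu integrable_lnG).
have AB : T `&` [set th | (s <= G (cot2 th))%R] `<=` B.
  move=> th [Tth /= sG]; split => //=.
  rewrite lee_fin ger0_norm //; apply: le_trans (ln2_ge R) _.
  have vb : a2 k ^+ 2 <= cot2 th.
    rewrite leNgt; apply/negP => vlt; have := hG (cot2 th).
    by rewrite cot2_ge0 ltW //= => /(_ isT); rewrite ltNge sG.
  rewrite ler_ln ?posrE // ?ltr_wpDr ?divr_ge0 ?cot2_ge0 ?(ltW a22) //.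
  have : 1 <= cot2 th / a2 k ^+ 2 by rewrite ler_pdivlMr // mul1r.
  lra.
have le1 : (mu (T `&` [set th | (s <= G (cot2 th))%R]) <= mu B)%E.
  by apply: le_measure => //; rewrite inE.
have Ih : (\int[mu]_(x in T) `|(EFin \o h) x| = (pi *+ 2 * poisson_int (0 : Cx R) h)%:E)%E.
  rewrite -(EFin_integral0 i2); apply: eq_integral => x _ /=.
  by rewrite ger0_norm.
rewrite Ih in hB.
have pp := pi2_gt0 R.
have le2 : ((1 / 2)%:E * mu (T `&` [set th | (s <= G (cot2 th))%R]) <= (pi *+ 2 * (2 / a2 k))%:E)%E.
  apply: le_trans (_ : (1 / 2)%:E * mu B <= _)%E; first by rewrite lee_pmul2l.
  by apply: le_trans hB _; rewrite lee_fin ler_wpM2l // ltW.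
have e4 : (4 / a2 k)%:E = ((2 * (pi *+ 2)^-1)%:E * (pi *+ 2 * (2 / a2 k))%:E)%E :> \bar R.
  rewrite -EFinM; congr EFin; rewrite mulrA divfK ?gt_eqF //.
  by rewrite mulrA -natrM.
have e1 : ((pi *+ 2)^-1)%:E = ((2 * (pi *+ 2)^-1)%:E * (1 / 2)%:E)%E :> \bar R.
  by rewrite -EFinM; congr EFin; rewrite mul1r mulrAC divff ?mul1r // pnatr_eq0.
rewrite /mT e1 e4 -muleA lee_pmul2l // lte_fin.
by rewrite mulr_gt0 // invr_gt0.
Qed.

End construction.

Lemma cvg_half_pow_dist (x : nat -> R) (l C : R) K :
  (forall k, (K <= k)%N -> `|l - x k| <= C * half_pow k) ->
  x @ \oo --> l.
Proof.
move=> h; apply/(@cvgrPdist_lt _ R^o) => e e0.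
have := @cvgr_dist_lt _ R^o _ _ eventually_filter _ _ (half_pow_cvg C) _ e0.
have n2 : \forall k \near \oo, (K <= k)%N by exists K.
move=> n1; apply: (@filterS _ _ eventually_filter _ _ _ (filterI n1 n2)) => k [] /=.
rewrite sub0r normrN => h1 Kk; apply: le_lt_trans (h k Kk) _.
exact: le_lt_trans (ler_norm _) h1.
Qed.

End smirnov.

Theorem mainTheorem1 (R : realType) :
  exists (f : Cx R -> Cx R) (fb : R -> Cx R),
    (* f analytic on D and non-constant *)
    analytic_on_disc f /\
    (exists z1 z2 : Cx R, udisc z1 /\ udisc z2 /\ f z1 <> f z2) /\
    (* fb are the non-tangential boundary values of f, a.e. on T *)
    {ae (@lebesgue_measure R), forall th, (@Tpar R) th -> nt_limit f (expi th) (fb th)} /\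
    (* (1) f in the Smirnov class N+ *)
    ((@lebesgue_measure R).-integrable ((@Tpar R)) (fun th => elog (modc (fb th))) /\
     forall z : Cx R, udisc z ->
       (elog (modc (f z)) <=
        ((pi *+ 2)^-1)%:E *
        \int[@lebesgue_measure R]_(th in (@Tpar R))
           (elog (modc (fb th)) * (poisson z th)%:E))%E) /\
    (* (2) liminf_{t -> oo} t m_f(t) = 0 *)
    limf_einf (fun t : R => (t%:E * distr_fun fb t)%E) (pinfty_nbhs R) = 0%E /\
    (* (3) Re f = 0 a.e. on T *)
    {ae (@lebesgue_measure R), forall th, (@Tpar R) th -> complex.Re (fb th) = 0}.
Proof.
have [E [r [t [K1 [a1 [K2 [a2 [E0 r0 rS H]]]]]]]] := iterated_steps R.
have rS' k : r k + 2 <= r k.+1.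
  by apply: le_trans (rS k); rewrite lerD2r lerDl sqr_ge0.
have Ecl k : pnorm (r k) (E k.+1 - E k) <= half_pow R k.+2 by have [[]] := H k.
have [g [dg [hg hdg]]] := limit_exists r0 rS' Ecl.
have E1 k y : 1 <= (E k).[y] by have [[]] := H k.
pose G x := complex.Re (g x%:C).
have hgx (x : R) k : `|x| + 2 <= r k -> modc (g x%:C - ((E k).[x])%:C) <= 2 * half_pow R k.
  by move=> xr; rewrite -evalC_real; apply: hg; rewrite modc_real.
have rK (x : R) : exists K, forall k, (K <= k)%N -> `|x| + 2 <= r k by exact: r_unbounded r0 rS' _.
have gx (x : R) : g x%:C = (G x)%:C.
  suff Im0 : complex.Im (g x%:C) = 0 by move: Im0; rewrite /G; case: (g x%:C) => a b /= ->.
  have [K hK] := rK x.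
  apply/eqP; rewrite -normr_le0; apply: (@le_half_pow_lim _ _ _ 2 K) => k Kk; rewrite add0r.
  apply: le_trans (hgx x k (hK k Kk)); apply: le_trans (Im_le_modc _).
  by case: (g x%:C) => a b /=; rewrite subr0.
have GE (x : R) k : `|x| + 2 <= r k -> `|G x - (E k).[x]| <= 2 * half_pow R k.
  by move=> /hgx; rewrite gx -rmorphB /= modc_real.
have EG (x : R) : (E k).[x] @[k --> \oo] --> G x.
  have [K hK] := rK x; apply: (@cvg_half_pow_dist R _ _ 2 K) => k Kk; exact/GE/hK.
have G1 (x : R) : 1 <= G x.
  have [K hK] := rK x; apply: (@le_half_pow_lim _ _ _ 2 K) => k Kk.
  by have := GE x k (hK k Kk); rewrite ler_norml => /andP[h _]; have := E1 k x; lra.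
pose f (z : Cx R) : Cx R := 'i%C * g (cayley2 z).
(* The formula for [f] makes sense off the point [1], so the boundary values are its own values and
   non-tangential limits reduce to continuity. *)
pose fb (th : R) : Cx R := f (expi th).
have fbE th : fb th = 'i%C * (G (cot2 th))%:C by rewrite /fb /f cayley2_expi gx.
have fbm th : modc (fb th) = G (cot2 th).
  by rewrite fbE modcM modc_i mul1r modc_real ger0_norm // (le_trans ler01).
have fbl th : elog (modc (fb th)) = (ln (G (cot2 th)))%:E.
  by rewrite fbm /elog gt_eqF // (lt_le_trans ltr01).
have df (z : Cx R) : 1 - z != 0 -> derivable f z 1.
  move=> z1; have [B B0 hB] := limit_taylor r0 rS' Ecl hg hdg (cayley2 z).
  exact: (@derivable_comp_cayley _ g z (dg (cayley2 z)) B).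
have K10 k : 0 <= K1 k by have [_ []] := H k.
have K20 k : 0 <= K2 k by have [_ []] := H k.
have a10 k : 0 < a1 k by have [_ []] := H k.
have a20 k : 0 < a2 k by have [_ []] := H k.
have Ka k : K1 k / a1 k + K2 k / a2 k <= half_pow R k.+2 by have [_ []] := H k.
have Eln k v : 0 <= v -> ln (E k.+1).[v] <= ln (E k).[v] + half_pow R k.+2 +
  K1 k * ln (1 + v / a1 k ^+ 2) + K2 k * ln (1 + v / a2 k ^+ 2) by have [_ _ _ _ h] := H k;
    exact: h.
have Gi := integrable_lnG E1 K10 K20 a10 a20 Ka Eln G1 EG.
exists f, fb; split; [|split; [|split; [|split; [split|split]]]].
- by move=> z zD; apply: df; exact: one_sub_neq0.
- have z3 : udisc ((3^-1)%:C : Cx R).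
    by rewrite /udisc /= modc_real gtr0_norm // invf_lt1 // ltr1n.
  (* These points go to [-1] and [-4], where [E 0] is 2 and 17; as [r 0] is 6, the limit differs
     from these values by at most 2. *)
  exists 0, ((3^-1)%:C : Cx R); split; first exact: udisc0.
  split => //.
  have v0 : cayley2 (0 : R[i]) = (-1)%:C by rewrite /cayley2 addr0 subr0 divr1 expr1n rmorphN
    rmorph1.
  have v3 : cayley2 ((3^-1)%:C : R[i]) = (-4)%:C.
    have e1 : 1 + (3^-1)%:C = (4 / 3)%:C :> R[i] by rewrite -(rmorph1 (real_complex R)) -rmorphD;
      congr (_%:C); lra.
    have e2 : 1 - (3^-1)%:C = (2 / 3)%:C :> R[i] by rewrite -(rmorph1 (real_complex R)) -rmorphB;
      congr (_%:C); lra.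
    by rewrite /cayley2 e1 e2 -fmorphV -rmorphM -rmorphXn -rmorphN; congr (_%:C); field.
  rewrite /f v0 v3 !gx => /(congr1 (@complex.Im R)) /=.
  have h1 := GE (-1) 0%N; have h4 := GE (-4) 0%N.
  have e1 : (E 0%N).[-1] = 2 by rewrite E0 hornerD hornerXn hornerC; lra.
  have e4 : (E 0%N).[-4] = 17 by rewrite E0 hornerD hornerXn hornerC; lra.
  rewrite !normrN r0 e1 e4 /half_pow expr0 normr1 (ger0_norm (ler0n _ 4)) in h1 h4.
  have /h1 : 1 + 2 <= 6 :> R by lra.
  have /h4 : 4 + 2 <= 6 :> R by lra.
  rewrite !ler_norml => /andP[u1 u2] /andP[u3 u4].
  lra.
- exists [set 0]; split => //.
    exact: lebesgue_measure_set1.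
  move=> th /= nT; apply: contrapT => th0; apply: nT => Tth alpha alpha1.
  have th2 : 0 < th < pi *+ 2.
    by move: Tth; rewrite /Tpar /= in_itv /= => /andP[h1 ->];
      rewrite andbT lt_neqAle h1 andbT eq_sym; apply/eqP.
  have c : {for expi th, continuous f}.
    apply: differentiable_continuous; apply/derivable1_diffP; apply: df; exact: expi_neq1.
  exact: cvg_within_filter c.
- have -> : (fun th => elog (modc (fb th))) =
  EFin \o (fun th => ln (G (cot2 th))) by apply/funext => th; rewrite fbl.
  exact: Gi.
- move=> z zD.
  have -> : (\int[lebesgue_measure]_(th in @Tpar R) (elog (modc (fb th)) * (poisson z th)%:E))%E =
    (pi *+ 2 * poisson_int z (fun th => ln (G (cot2 th))))%:E.
    by rewrite -(EFin_poisson_int zD Gi); apply: eq_integral => th _; rewrite fbl EFinM.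
  rewrite -EFinM mulKf; last by rewrite gt_eqF // pi2_gt0.
  rewrite /elog; case: eqP => [_|/eqP fz]; first exact: leNye.
  rewrite lee_fin.
  have gz : g (cayley2 z) != 0 by move: fz; rewrite modc_eq0 /f mulf_eq0 negb_or => /andP[].
  have -> : modc (f z) = modc (g (cayley2 z)) by rewrite /f modcM modc_i mul1r.
  apply: (ln_modc_limit_le E1 K10 K20 a10 a20 Ka Eln G1 EG zD gz).
  have [K hK] := r_unbounded r0 rS' (modc (cayley2 z) + 2).
  apply: (@cvg_half_pow_dist R _ _ 2 K) => k Kk.
  rewrite sub0r normrN ger0_norm ?modc_ge0 // -modcN opprB; exact/hg/hK.
(* On [[0, a2 k ^+ 2]] the limit exceeds [E k.+1] by at most [2 * half_pow k.+1 <= 1], so it stays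
   below the level [t k + 2]. The constant 12 combines the 4 of [distribution_bound] with
   [t k + 2 <= 3 * t k]. *)
- have Dk k : ((t k + 2)%R%:E * distr_fun fb (t k + 2)%R <= (12 * half_pow R k.+2)%:E)%E.
    have [[_ _ tk] _ ta tG _] := H k.
    have ht := half_pow_gt0 R k.+2.
    have t0 : 1 <= t k.
      apply: le_trans tk; rewrite invf_ge1 //; have := @half_pow_le R 0 k.+2 isT;
        by rewrite /half_pow expr0.
    have s0 : 0 < t k + 2 by lra.
    have hG v : 0 <= v <= a2 k ^+ 2 -> G v < t k + 2.
      move=> hv; have /andP[v0 va] := hv.
      have := GE v k.+1; rewrite ger0_norm // => hh.
      have : v + 2 <= r k.+1 by have := rS k; have := r_gt0 r0 rS' k; lra.
      move/hh; rewrite ler_norml => /andP[_ h2].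
      have := tG v hv; have := half_powS R 0; have := @half_pow_le R 1 k.+1 isT.
      have h0 : half_pow R 0 = 1 by exact: expr0.
      lra.
    have mE : distr_fun fb (t k + 2) = mT [set th | (t k + 2 <= G (cot2 th))%R].
      by rewrite /distr_fun; congr mT; apply/seteqP; split => th /=; rewrite fbm.
    rewrite mE; have hb := distribution_bound E1 K10 K20 a10 a20 Ka Eln G1 EG s0 hG.
    apply: le_trans (_ : (t k + 2)%:E * (4 / a2 k)%:E <= _)%E; first by rewrite lee_pmul2l.
    rewrite -EFinM lee_fin mulrA ler_pdivrMr //.
    move: ta; rewrite ler_pdivrMr // => ta; nra.
  rewrite limf_einfE; apply/eqP; rewrite eq_le; apply/andP; split.
    (* Every neighbourhood of infinity contains a level [t K + 2] with small product, because [t K]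
       is at least [(half_pow K.+2)^-1]. *)
    apply: ge_ereal_sup => _ [V /= [M [Mr MV]] <-].
    apply/lee_addgt0Pr => e e0; rewrite add0e.
    have n1 := @cvgr_dist_lt _ R^o _ _ eventually_filter _ _ (half_pow_cvg 12) _ e0.
    have n2 := @cvgr_dist_lt _ R^o _ _ eventually_filter _ _ (half_pow_cvg (`|M| + 1)) _ ltr01.
    have [K _ hK] := filterI n1 n2.
    have [] := hK K (leqnn K); rewrite /= !sub0r !normrN => h1 h2.
    have hs : half_pow R K.+2 <= half_pow R K by apply: half_pow_le; rewrite -addn2 leq_addr.
    have hp := half_pow_gt0 R K; have hp2 := half_pow_gt0 R K.+2.
    apply: ge_ereal_inf; exists ((t K + 2)%:E * distr_fun fb (t K + 2))%E.
      exists (t K + 2) => //; apply: MV.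
      have [[_ _ tk] _ _ _ _] := H K.
      have : (half_pow R K)^-1 <= t K by apply: le_trans tk; rewrite lef_pV2 ?posrE.
      have : `|M| + 1 < (half_pow R K)^-1.
        by rewrite -[X in _ < X]mul1r ltr_pdivlMr //; apply: le_lt_trans (ler_norm _) h2.
      have := ler_norm M; lra.
    apply: le_trans (Dk K) _; rewrite lee_fin.
    have := ler_norm (12 * half_pow R K); lra.
  pose I := (fun s : R => (s%:E * distr_fun fb s)%E) @` [set s : R | 0 < s].
  have I0 : (0 <= ereal_inf I)%E.
    apply: le_ereal_inf_tmp => _ [s /= s0 <-].
    rewrite mule_ge0 ?lee_fin ?(ltW s0) // /distr_fun /mT mule_ge0 ?measure_ge0 //.
    by rewrite lee_fin invr_ge0 ltW // pi2_gt0.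
  apply: (le_trans I0); apply: ereal_sup_ubound; exists [set s : R | 0 < s] => //.
  by exists 0; split.
- by apply: aeW => th _; rewrite fbE /= mul0r mulr0 subr0.
Qed.
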